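(* Let $P$ be a Jordan-Kantor pair over $k$, and let $D^0$ be a Lie algebra together with central extensions $\mathfrak{uider}(P)\xrightarrow{f}D^0\xrightarrow{g}\mathfrak{ider}(P)$ with $g\circ f=\mathfrak{ud}$; let $\hat L(D^0)=P\oplus D^0$ be the associated algebra. (i) $\hat L(D^0)$ is a $5$-graded Lie algebra. (ii) There are unique graded central extensions $\hat f:\mathrm{ULE}(P)\to\hat L(D^0)$ and $\hat g:\hat L(D^0)\to\mathrm{TKK}(P)$ such that $\hat f|_P=\hat g|_P=\mathrm{id}_P$. (iii) $\mathrm{ULE}$ is a covariant functor from the category of Jordan-Kantor pairs to the category of Lie algebras. In particular, for every homomorphism $h:P\to Q$ of Jordan-Kantor pairs, $\mathrm{ULE}(h):\mathrm{ULE}(P)\to\mathrm{ULE}(Q)$ is the unique Lie algebra homomorphism whose composition with the inclusion $P\hookrightarrow\mathrm{ULE}(P)$ equals the composition of $h$ with the inclusion $Q\hookrightarrow\mathrm{ULE}(Q)$.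
   Context: Let $k$ be a commutative associative unital ring; $\sigma\in\{+,-\}$. A central extension of a Lie algebra $L$ is a surjective Lie algebra homomorphism $f:L'\to L$ with $\ker f$ contained in the centre of $L'$. Jordan-Kantor pair: $P=(J,M)$ with $J=(J^+,J^-)$, $M=(M^+,M^-)$ pairs of $k$-modules, together with quadratic maps $Q^\sigma:J^\sigma\to\mathrm{Hom}_k(J^{-\sigma},J^\sigma)$, bilinear maps $J^\sigma\times M^{-\sigma}\to M^\sigma$, $(a,y)\mapsto a\circ y$, bilinear maps $V^\sigma:M^\sigma\times M^{-\sigma}\to\mathrm{End}_k(M^\sigma)$ (write $\{x,y,z\}=V_{x,y}z$) and bilinear maps $\kappa:M^\sigma\times M^\sigma\to J^\sigma$ such that: (1) $J$ is a Jordan pair: with $Q_{a,c}=Q_{a+c}-Q_a-Q_c$ and $\{a,b,c\}=D_{a,b}c=Q_{a,c}b$, the identities $D_{a,b}Q_a=Q_aD_{b,a}$, $D_{Q_ab,b}=D_{a,Q_ba}$, $Q_{Q_ab}=Q_aQ_bQ_a$ hold in all scalar extensions; (2) $\{a,b,c\}\circ y=a\circ(b\circ(c\circ y))+c\circ(b\circ(a\circ y))$; (3) $[V_{x,y},V_{z,w}]=V_{V_{x,y}z,w}-V_{z,V_{y,x}w}$; (4) $\kappa(x,x)=0$; (5) $\kappa(x,z)\circ y=\{x,y,z\}-\{z,y,x\}$; $\kappa(x,z)\circ(b\circ u)=\{z,b\circ x,u\}-\{x,b\circ z,u\}$; $\kappa(b\circ x,y)\circ z=b\circ\{x,y,z\}+\{y,x,b\circ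 z\}$; $\{\kappa(x,z),b,a\}=\kappa(a\circ(b\circ x),z)+\kappa(x,a\circ(b\circ z))$; $\{a,\kappa(y,w),c\}=\kappa(a\circ w,c\circ y)+\kappa(c\circ w,a\circ y)$; $\kappa(\kappa(z,u)\circ y,x)=\kappa(\{x,y,z\},u)+\kappa(z,\{x,y,u\})$; for all $a,c\in J^\sigma$, $b\in J^{-\sigma}$, $x,u,z\in M^\sigma$, $y,w\in M^{-\sigma}$. A homomorphism of Jordan-Kantor pairs $P\to P'$ is a quadruple of linear maps $J^\pm\to J'^\pm$, $M^\pm\to M'^\pm$ compatible with the maps $Q$, $V$, $\kappa$ and $\circ$. Also write $P$ for the $k$-module $J^-\oplus M^-\oplus M^+\oplus J^+$, graded by $P^{\pm2}=J^\pm$, $P^{\pm1}=M^\pm$. For $(a,b)\in J^+\times J^-$, $(x,y)\in M^+\times M^-$ define degree-preserving endomorphisms of $P$: $\delta(a,b)$ acts as $D_{a,b}$ on $J^+$, $-D_{b,a}$ on $J^-$, $z\mapsto a\circ(b\circ z)$ on $M^+$, $w\mapsto-b\circ(a\circ w)$ on $M^-$; $v(x,y)$ acts as $V_{x,y}$ on $M^+$, $-V_{y,x}$ on $M^-$, $c\mapsto\kappa(c\circ y,x)$ on $J^+$, $d\mapsto-\kappa(d\circ x,y)$ on $J^-$. $\mathfrak{ider}(P)$ is the span of all $\delta(a,b)$, $v(x,y)$, a Lie algebra under the commutator. $\mathfrak{uider}(P)=\big((J^+\otimes J^-)\oplus(M^+\otimes M^-)\big)/I(P)$, where $I(P)$ is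 spanned by: $x\otimes\{y,x,y\}-\{x,y,x\}\otimes y$; $\{x,y,u\}\otimes w+\{u,w,x\}\otimes y-u\otimes\{y,x,w\}-x\otimes\{w,u,y\}$; $a\otimes\{b,a,b\}-\{a,b,a\}\otimes b$; $\{a,b,c\}\otimes d-c\otimes\{b,a,d\}+\{c,d,a\}\otimes b-a\otimes\{b,c,d\}$; $\kappa(u,x)\otimes b-x\otimes(b\circ u)+u\otimes(b\circ x)$; $a\otimes\kappa(y,w)-(a\circ y)\otimes w+(a\circ w)\otimes y$, for $a,c\in J^+$, $b,d\in J^-$, $x,u\in M^+$, $y,w\in M^-$. Cosets are written $a\diamond b$, $x\diamond y$. $\mathfrak{ider}(P)$ acts by $T.(p\diamond q)=T.p\diamond q+p\diamond T.q$; the linear map $\mathfrak{ud}:\mathfrak{uider}(P)\to\mathfrak{ider}(P)$, $a\diamond b\mapsto\delta(a,b)$, $x\diamond y\mapsto v(x,y)$, is well defined, $\mathfrak{uider}(P)$ is a Lie algebra with $[p,q]=\mathfrak{ud}(p).q$, and $\mathfrak{ud}$ is a central extension. A homomorphism $h:P\to Q$ induces a Lie algebra homomorphism $\mathfrak{uider}(h):p\diamond q\mapsto h(p)\diamond h(q)$. The algebra $\hat L(D^0)=P\oplus D^0$ ($D^0$ in degree $0$) has the bilinear product: the given bracket on $D^0$; $[X,p]=g(X).p=-[p,X]$ for $X\in D^0$, $p\in P$; for $(a,x),(c,u)\in J^+\oplus M^+$ and $(b,y),(d,w)\in J^-\oplus M^-$: $[(a,x),(b,y)]=a\circ y+f(a\diamond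 b)+f(x\diamond y)-b\circ x=-[(b,y),(a,x)]$, $[(a,x),(c,u)]=\kappa(x,u)\in J^+$, $[(b,y),(d,w)]=\kappa(y,w)\in J^-$. $5$-graded means $\mathbb Z$-graded with support in $\{-2,\dots,2\}$. $\mathrm{TKK}(P)=\hat L(\mathfrak{ider}(P))$ (with $f=\mathfrak{ud}$, $g=\mathrm{id}$) and $\mathrm{ULE}(P)=\hat L(\mathfrak{uider}(P))$ (with $f=\mathrm{id}$, $g=\mathfrak{ud}$). For a homomorphism $h:P\to Q$, $\mathrm{ULE}(h)=h\oplus\mathfrak{uider}(h):P\oplus\mathfrak{uider}(P)\to Q\oplus\mathfrak{uider}(Q)$. *)

(* Defs.v *)
From HB Require Import structures.
From mathcomp Require Import all_boot all_algebra.
From mathcomp Require Import finmap boolp classical_sets functions cardinality fsbigop.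

Set Implicit Arguments.
Unset Strict Implicit.
Unset Printing Implicit Defensive.

Import GRing.Theory.

Local Open Scope classical_set_scope.
Local Open Scope ring_scope.
Local Open Scope quotient_scope.

Definition is_linear (k : pzRingType) (U V : lmodType k) (f : U -> V) : Prop :=
  forall (c : k) (u v : U), f (c *: u + v) = c *: f u + f v.

Definition is_bilinear (k : pzRingType) (U V W : lmodType k)
    (f : U -> V -> W) : Prop :=
  (forall u, is_linear (f u)) /\ (forall v, is_linear (f^~ v)).

Section Span.
Variables (k : pzRingType) (V : lmodType k).

Definition submodule (W : set V) : Prop :=
  W 0 /\ forall (c : k) (u v : V), W u -> W v -> W (c *: u + v).

Definition span (S : set V) : pred V := fun v =>
  `[< forall W : set V, submodule W -> S `<=` W -> W v >].

Variable S : set V.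

Lemma span_gen v : S v -> v \in span S.
Proof. by move=> Sv; apply/asboolP => W _; apply. Qed.

Lemma span_submod_closed : GRing.submod_closed (span S).
Proof.
split; first by apply/asboolP => W [].
move=> c u v /asboolP Su /asboolP Sv; apply/asboolP => W WV SW.
by apply: (WV.2); [apply: Su | apply: Sv].
Qed.

HB.instance Definition _ :=
  GRing.isSubmodClosed.Build k V (span S) span_submod_closed.

Lemma span_ind (W : set V) v :
  v \in span S -> submodule W -> S `<=` W -> W v.
Proof. by move=> /asboolP; apply. Qed.

(* The submodule of V spanned by S, as a module. *)
Record spanmod := Spanmod { spanmod_val : V; _ : spanmod_val \in span S }.

HB.instance Definition _ := [isSub for spanmod_val].
HB.instance Definition _ := [Choice of spanmod by <:].
HB.instance Definition _ := [SubChoice_isSubLmodule of spanmod by <:].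

Definition quotmod := Quotient.quot (GRing.ZmodClosed.clone V (span S) _).

HB.instance Definition _ := GRing.Zmodule.on quotmod.
HB.instance Definition _ := EqQuotient.on quotmod.

Definition qpi (v : V) : quotmod := \pi_quotmod v.

Lemma qpiD : {morph qpi : u v / u + v}.
Proof. exact: (@Quotient.pi_add V (GRing.ZmodClosed.clone V (span S) _)). Qed.

Lemma qpi_eq u v : (qpi u = qpi v) <-> (u - v \in span S).
Proof.
have E := @Quotient.idealrBE V (GRing.ZmodClosed.clone V (span S) _) u v.
by split=> [e|]; [rewrite E; apply/eqP | rewrite E => /eqP].
Qed.

Lemma reprK_qpi (x : quotmod) : qpi (repr x) = x.
Proof. exact: reprK. Qed.

Definition quot_scale (c : k) (x : quotmod) : quotmod := qpi (c *: repr x).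

Lemma quot_scale_qpi c v : quot_scale c (qpi v) = qpi (c *: v).
Proof.
apply/qpi_eq; rewrite -scalerBr rpredZ //.
by apply/qpi_eq; rewrite reprK_qpi.
Qed.

Fact quot_scalerA a b x : quot_scale a (quot_scale b x) = quot_scale (a * b) x.
Proof. by rewrite -[x]reprK_qpi !quot_scale_qpi scalerA. Qed.

Fact quot_scale1r : left_id 1 quot_scale.
Proof. by move=> x; rewrite -[x]reprK_qpi quot_scale_qpi scale1r. Qed.

Fact quot_scalerDr : right_distributive quot_scale +%R.
Proof.
move=> c x y; rewrite -[x]reprK_qpi -[y]reprK_qpi -qpiD.
by rewrite !quot_scale_qpi scalerDr qpiD.
Qed.

Fact quot_scalerDl x : {morph quot_scale^~ x : a b / a + b}.
Proof.
by move=> a b; rewrite -[x]reprK_qpi !quot_scale_qpi scalerDl qpiD.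
Qed.

HB.instance Definition _ := GRing.Zmodule_isLmodule.Build k quotmod
  quot_scalerA quot_scale1r quot_scalerDr quot_scalerDl.

Lemma qpi_is_linear : is_linear qpi.
Proof. by move=> c u v; rewrite qpiD -quot_scale_qpi. Qed.

(* Defined through representatives: it is the linear map V / span S -> W    *)
(* induced by f as soon as f is linear and vanishes on S, see qlift_qpi.    *)
Definition qlift (W : Type) (f : V -> W) (x : quotmod) : W := f (repr x).

Section Lift.
Variables (W : lmodType k) (f : V -> W).
Hypotheses (linf : is_linear f) (f0 : forall v, S v -> f v = 0).

Let f_0 : f 0 = 0.
Proof.
have := linf 1 0 0; rewrite scaler0 addr0 scale1r => /eqP.
by rewrite addrC -subr_eq subrr eq_sym => /eqP.
Qed.

Lemma qlift_qpi v : qlift f (qpi v) = f v.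
Proof.
have : repr (qpi v) - v \in span S by apply/qpi_eq; rewrite reprK_qpi.
move=> H; have : f (repr (qpi v) - v) = 0.
  apply: (span_ind (W := [set u | f u = 0]) H) => //; split => //= c u w fu fw.
  by rewrite linf fu fw scaler0 addr0.
rewrite -[X in f X]addrC -scaleN1r linf scaleN1r addrC => /eqP.
by rewrite subr_eq0 => /eqP.
Qed.

Lemma qlift_is_linear : is_linear (qlift f).
Proof.
move=> c x y; rewrite -[x]reprK_qpi -[y]reprK_qpi -qpi_is_linear.
by rewrite !qlift_qpi linf.
Qed.

End Lift.

End Span.

(* The free k-module on G: finitely supported functions G -> k. *)
Section FreeModule.
Variables (k : pzRingType) (G : choiceType).

Definition finsupp : pred (G -> k^o) := fun f =>
  `[< finite_set [set g | f g != 0] >].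

Fact finsupp_submod_closed : GRing.submod_closed finsupp.
Proof.
split.
  apply/asboolP; rewrite (_ : [set _ | _] = set0) //.
  by apply/seteqP; split => g //=; rewrite eqxx.
move=> c u v /asboolP fu /asboolP fv; apply/asboolP.
apply: (@sub_finite_set _ _ ([set g | u g != 0] `|` [set g | v g != 0])).
  move=> g /=; have [u0|] := eqVneq (u g) 0; last by left.
  have [v0|] := eqVneq (v g) 0; last by right.
  suff -> : (c *: u + v) g = 0 by rewrite eqxx.
  by rewrite -[LHS]/(c *: u g + v g) u0 v0 scaler0 addr0.
by rewrite finite_setU.
Qed.

HB.instance Definition _ :=
  GRing.isSubmodClosed.Build k (G -> k^o) finsupp finsupp_submod_closed.

Record freemod := Freemod { coef : G -> k^o; _ : coef \in finsupp }.

HB.instance Definition _ := [isSub for coef].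
HB.instance Definition _ := [Choice of freemod by <:].
HB.instance Definition _ := [SubChoice_isSubLmodule of freemod by <:].

Fact delta_finsupp (g : G) : (fun g' => (g' == g)%:R : k^o) \in finsupp.
Proof.
apply/asboolP; apply: (@sub_finite_set _ _ [set g]); last exact: finite_set1.
by move=> g' /=; have [//|_] := eqVneq g' g; rewrite eqxx.
Qed.

Definition delta (g : G) : freemod := Freemod (delta_finsupp g).

(* The linear map freemod -> W sending each delta g to F g. *)
Definition freelift (W : lmodType k) (F : G -> W) (t : freemod) : W :=
  \sum_(g \in [set: G]) (coef t g : k) *: F g.

Lemma freelift_is_linear (W : lmodType k) (F : G -> W) :
  is_linear (freelift F).
Proof.
have fin (t : freemod) : finite_set [set g | coef t g != 0].
  exact: asboolW (valP t).
move=> c u v; rewrite /freelift.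
pose A := [set g | coef u g != 0] `|` [set g | coef v g != 0].
have finA : finite_set A by rewrite finite_setU.
have E (t : freemod) : [set g | coef t g != 0] `<=` A ->
    \sum_(g \in [set: G]) (coef t g : k) *: F g =
    \sum_(g \in A) (coef t g : k) *: F g.
  move=> tA; apply/esym/fsbig_widen => // g [_ nAg] /=.
  suff -> : coef t g = 0 by rewrite scale0r.
  by apply: contrapT => /eqP t0; apply: nAg; apply: tA.
have uA : [set g | coef u g != 0] `<=` A by move=> g; left.
have vA : [set g | coef v g != 0] `<=` A by move=> g; right.
have uvA : [set g | coef (c *: u + v) g != 0] `<=` A.
  move=> g /= /eqP uvg; apply: contrapT => nA; apply: uvg.
  have u0 : coef u g = 0 by apply: contrapT => /eqP ?; apply: nA; left.
  have v0 : coef v g = 0 by apply: contrapT => /eqP ?; apply: nA; right.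
  by rewrite -[LHS]/(c * coef u g + coef v g) u0 v0 mulr0 addr0.
rewrite !E //.
rewrite !fsbig_finite //= scaler_sumr -big_split /=.
by apply: eq_bigr => g _; rewrite scalerA -scalerDl.
Qed.

Lemma freelift_delta (W : lmodType k) (F : G -> W) g :
  freelift F (delta g) = F g.
Proof.
rewrite /freelift -(@fsbig_widen _ _ _ _ [set g]) ?fsbig_set1 /= ?eqxx ?scale1r //.
by move=> g' [_ /eqP/negPf /= ->]; rewrite scale0r.
Qed.

Lemma freemod_ind (W : set freemod) t :
  submodule W -> (forall g, W (delta g)) -> W t.
Proof.
move=> [W0 WD] Wd.
have fin : finite_set [set g | coef t g != 0] by exact: asboolW (valP t).
pose X := fset_set [set g | coef t g != 0].
suff -> : t = \sum_(g <- X) (coef t g : k) *: delta g.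
  by apply: (big_ind W) => // [x y Wx Wy|g _];
    [rewrite -[x]scale1r | rewrite -[_ *: _]addr0]; apply: WD.
apply/val_inj/funext => g.
rewrite (raddf_sum (val : freemod -> G -> k^o)) fct_sumE.
rewrite -[LHS]/(coef t g).
have [gX|gX] := boolP (g \in X).
  rewrite (bigD1_seq g) ?fset_uniq //= big1 ?addr0.
    by rewrite -[RHS]/(coef t g * (g == g)%:R) eqxx mulr1.
  move=> g' /negPf g'g.
  by rewrite -[LHS]/(coef t g' * (g == g')%:R) eq_sym g'g mulr0.
rewrite big_seq big1.
  move: gX; rewrite in_fset_set // => /negP; rewrite in_setE /=.
  by move/negP; rewrite negbK => /eqP.
move=> g' g'X; rewrite -[LHS]/(coef t g' * (g == g')%:R).
by have [gg'|_] := eqVneq g g'; [rewrite gg' g'X in gX | rewrite mulr0].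
Qed.

End FreeModule.

Section Tensor.
Variables (k : comPzRingType) (A B : lmodType k).

Definition tens_rel : set (freemod k (A * B)%type) := [set t |
  [\/ exists a a' b, t = delta k (a + a', b) - delta k (a, b) - delta k (a', b),
      exists a b b', t = delta k (a, b + b') - delta k (a, b) - delta k (a, b'),
      exists c a b, t = delta k (c *: a, b) - c *: delta k (a, b)
    | exists c a b, t = delta k (a, c *: b) - c *: delta k (a, b)]].

Definition tens : Type := quotmod tens_rel.
HB.instance Definition _ := GRing.Lmodule.on tens.

Definition tensor (a : A) (b : B) : tens := qpi tens_rel (delta k (a, b)).

(* The linear map tens -> W induced by a bilinear map f : A -> B -> W. *)
Definition tlift (W : lmodType k) (f : A -> B -> W) : tens -> W :=
  @qlift k _ tens_rel W (freelift (fun p => f p.1 p.2)).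

Lemma tensor_is_bilinear : is_bilinear tensor.
Proof.
have lin := @qpi_is_linear _ _ tens_rel.
have D u v w : u - v - w \in span tens_rel ->
    qpi tens_rel u = qpi tens_rel v + qpi tens_rel w.
  by rewrite -addrA -opprD => h; rewrite -qpiD; apply/qpi_eq.
have Z c u v : u - c *: v \in span tens_rel ->
    qpi tens_rel u = c *: qpi tens_rel v.
  by move=> h; rewrite -[RHS]/(quot_scale c (qpi _ v)) quot_scale_qpi; apply/qpi_eq.
split=> x c u v; rewrite /tensor.
- rewrite (D _ (delta k (x, c *: u)) (delta k (x, v))); last first.
    by apply: span_gen; apply: Or42; exists x, (c *: u), v.
  congr (_ + _); apply: Z.
  by apply: span_gen; apply: Or44; exists c, x, u.
- rewrite (D _ (delta k (c *: u, x)) (delta k (v, x))); last first.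
    by apply: span_gen; apply: Or41; exists (c *: u), v, x.
  congr (_ + _); apply: Z.
  by apply: span_gen; apply: Or43; exists c, u, x.
Qed.

Section Lift.
Variables (W : lmodType k) (f : A -> B -> W).
Hypothesis bilf : is_bilinear f.

Let F := freelift (fun p : A * B => f p.1 p.2).

Let linF : is_linear F. Proof. exact: freelift_is_linear. Qed.

Let FB u v : F (u - v) = F u - F v.
Proof. by have := linF (-1) v u; rewrite !scaleN1r addrC => ->; rewrite addrC. Qed.

Let F0 : F 0 = 0. Proof. by rewrite -(subrr 0) FB subrr. Qed.

Let FZ c u : F (c *: u) = c *: F u.
Proof. by rewrite -[c *: u]addr0 linF F0 addr0. Qed.

Let Fd p : F (delta k p) = f p.1 p.2. Proof. exact: freelift_delta. Qed.

Let kill v : tens_rel v -> F v = 0.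
Proof.
have l1 a c u w : f a (c *: u + w) = c *: f a u + f a w by apply: bilf.1.
have l2 b c u w : f (c *: u + w) b = c *: f u b + f w b by apply: (bilf.2 b).
have z1 a : f a 0 = 0.
  by apply: (addIr (f a 0)); rewrite -{1}[f a 0]scale1r -l1 scaler0 !add0r.
have z2 b : f 0 b = 0.
  by apply: (addIr (f 0 b)); rewrite -{1}[f 0 b]scale1r -l2 scaler0 !add0r.
case=> -[x] [y] [z] ->; rewrite ?FB ?FZ !Fd /=.
- by have := l2 z 1 x y; rewrite !scale1r => ->; rewrite addrAC addrK subrr.
- by have := l1 x 1 y z; rewrite !scale1r => ->; rewrite addrAC addrK subrr.
- by rewrite -[x *: y]addr0 l2 z2 addr0 subrr.
- by rewrite -[x *: z]addr0 l1 z1 addr0 subrr.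
Qed.

Lemma tlift_is_linear : is_linear (tlift f).
Proof. exact: (qlift_is_linear linF kill). Qed.

Lemma tlift_tensor a b : tlift f (tensor a b) = f a b.
Proof. by rewrite /tlift (qlift_qpi linF kill) Fd. Qed.

End Lift.

Lemma tens_ind (W : set tens) z :
  submodule W -> (forall a b, W (tensor a b)) -> W z.
Proof.
move=> [W0 WD] Wt; rewrite -[z]reprK_qpi.
apply: (freemod_ind (W := [set t | W (qpi tens_rel t)])) => [|[a b]]; last exact: Wt.
have lin := @qpi_is_linear _ _ tens_rel.
split=> [/=|c u v /= Wu Wv]; last by rewrite lin; apply: WD.
by have := lin (-1) 0 0; rewrite scaler0 addr0 scaleN1r addNr => ->.
Qed.

End Tensor.

(* The scalar extension of the k-module V, with its K-module structure. *)
Section BaseChange.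
Variables (k : comPzRingType) (K : comAlgType k) (V : lmodType k).

Definition base_change : Type := tens K V.
HB.instance Definition _ := GRing.Zmodule.on base_change.

Definition bc_tensor (s : K) (v : V) : base_change := tensor s v.

Definition bc_scale (t : K) (z : base_change) : base_change :=
  tlift (fun (s : K) (v : V) => tensor (t * s) v) z.

Let bil t : is_bilinear (fun (s : K) (v : V) => tensor (t * s) v).
Proof.
have [t1 t2] := tensor_is_bilinear K V.
split=> [s|v] c u w /=; first exact: t1.
by rewrite mulrDr -scalerAr; apply: (t2 v).
Qed.

Fact bc_scale_tensor t s v : bc_scale t (tensor s v) = tensor (t * s) v.
Proof. exact: (tlift_tensor (bil t)). Qed.

Let ext (f g : base_change -> base_change) :
  is_linear (f : tens K V -> tens K V) ->
  is_linear (g : tens K V -> tens K V) ->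
  (forall s v, f (tensor s v) = g (tensor s v)) -> f =1 g.
Proof.
move=> lf lg fg z; apply: (tens_ind (W := [set z | f z = g z])) => //.
have H0 (h : tens K V -> tens K V) : is_linear h -> h 0 = 0.
  by move=> lh; have := lh (-1) 0 0; rewrite scaler0 addr0 scaleN1r addNr.
split=> [/=|c u v /= fu fv]; first by rewrite !H0.
by rewrite lf lg fu fv.
Qed.

Let lin t : is_linear (bc_scale t : tens K V -> tens K V).
Proof. exact: (tlift_is_linear (bil t)). Qed.

Fact bc_scalerA a b z : bc_scale a (bc_scale b z) = bc_scale (a * b) z.
Proof.
move: z; apply: ext (lin _) _ => [c u v|s v]; first by rewrite !lin.
by rewrite !bc_scale_tensor mulrA.
Qed.

Fact bc_scale1r : left_id 1 bc_scale.
Proof.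
move=> z; move: z; apply: ext (lin _) _ _ => [c u v //|s v].
by rewrite bc_scale_tensor mul1r.
Qed.

Fact bc_scalerDr : right_distributive bc_scale +%R.
Proof. by move=> a u v; have := lin a 1 u v; rewrite !scale1r. Qed.

Fact bc_scalerDl z : {morph bc_scale^~ z : a b / a + b}.
Proof.
move=> a b; move: z; apply: (ext (lin _)) => [c u v|s v].
  by rewrite !lin scalerDr addrACA.
have [_ t2] := tensor_is_bilinear K V.
rewrite !bc_scale_tensor mulrDl.
by have := t2 v 1 (a * s) (b * s); rewrite !scale1r.
Qed.

HB.instance Definition _ := GRing.Zmodule_isLmodule.Build K base_change
  bc_scalerA bc_scale1r bc_scalerDr bc_scalerDl.

End BaseChange.

Section Quadratic.
Variables (k : pzRingType).

Definition polar (U W : lmodType k) (q : U -> W) (a c : U) : W :=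
  q (a + c) - q a - q c.

Definition is_quadratic (U W : lmodType k) (q : U -> W) : Prop :=
  (forall (c : k) (u : U), q (c *: u) = c ^+ 2 *: q u) /\ is_bilinear (polar q).

(* Q is a quadratic map U -> Hom(V, U). *)
Definition is_quadratic_hom (U V : lmodType k) (Q : U -> V -> U) : Prop :=
  (forall a, is_linear (Q a)) /\ (forall b, is_quadratic (Q^~ b)).

(* The triple product {a, b, c} = D_{a,b} c = Q_{a,c} b. *)
Definition jD (U V : lmodType k) (Q : U -> V -> U) (a : U) (b : V) (c : U) : U :=
  polar (Q^~ b) a c.

Definition jordan_identities (U V : lmodType k)
    (Q : U -> V -> U) (Q' : V -> U -> V) : Prop :=
  forall (a : U) (b : V),
  [/\ forall c, jD Q a b (Q a c) = Q a (jD Q' b a c),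
      forall c, jD Q (Q a b) b c = jD Q a (Q' b a) c
    & forall c, Q (Q a b) c = Q a (Q' b (Q a c))].

End Quadratic.

(* The identities are required of the scalar extensions (QK, QK') of (Q, Q') *)
(* to every commutative k-algebra K; a quadratic map extends uniquely to     *)
(* K-modules, so that QK and QK' are determined by the conditions below. A   *)
(* comAlgType is nonzero; over the zero algebra there is nothing to require. *)
Definition jordan_pair (k : comPzRingType) (U V : lmodType k)
    (Q : U -> V -> U) (Q' : V -> U -> V) : Prop :=
  [/\ is_quadratic_hom Q, is_quadratic_hom Q' &
  forall K : comAlgType k,
  exists (QK : base_change K U -> base_change K V -> base_change K U)
         (QK' : base_change K V -> base_change K U -> base_change K V),
  [/\ is_quadratic_hom QK /\ is_quadratic_hom QK',
      forall a b, QK (bc_tensor 1 a) (bc_tensor 1 b) = bc_tensor 1 (Q a b),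
      forall b a, QK' (bc_tensor 1 b) (bc_tensor 1 a) = bc_tensor 1 (Q' b a),
      jordan_identities QK QK' & jordan_identities QK' QK]].

(* J^+ = Jp, J^- = Jm, M^+ = Mp, M^- = Mm; a field with suffix p is the      *)
(* operation with values in J^+ or M^+, one with suffix m takes values in    *)
(* J^- or M^-: actp a y is a o y, Vp x y z is {x, y, z}, kapp is kappa.      *)
Record jkdata (k : comPzRingType) := JKData {
  Jp : lmodType k; Jm : lmodType k; Mp : lmodType k; Mm : lmodType k;
  Qp : Jp -> Jm -> Jp;       Qm : Jm -> Jp -> Jm;
  actp : Jp -> Mm -> Mp;     actm : Jm -> Mp -> Mm;
  Vp : Mp -> Mm -> Mp -> Mp; Vm : Mm -> Mp -> Mm -> Mm;
  kapp : Mp -> Mp -> Jp;     kapm : Mm -> Mm -> Jm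
}.

Section JordanKantor.
Variable k : comPzRingType.

Definition jkopp (D : jkdata k) : jkdata k :=
  JKData (@Qm k D) (@Qp k D) (@actm k D) (@actp k D)
         (@Vm k D) (@Vp k D) (@kapm k D) (@kapp k D).

(* The axioms other than the Jordan pair axioms, for sigma = +; those for    *)
(* sigma = - are the same axioms for jkopp D.                                *)
Definition jk_axioms (D : jkdata k) : Prop :=
  [/\ [/\ is_bilinear (@actp k D), forall z : Mp D, is_bilinear (fun x y => Vp x y z),
          forall (x : Mp D) (y : Mm D), is_linear (Vp x y)
        & is_bilinear (@kapp k D)],
      forall (a c : Jp D) (b : Jm D) (y : Mm D),
        actp (jD (@Qp k D) a b c) y =
        actp a (actm b (actp c y)) + actp c (actm b (actp a y)),
      forall (x z t : Mp D) (y w : Mm D),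
        Vp x y (Vp z w t) - Vp z w (Vp x y t) =
        Vp (Vp x y z) w t - Vp z (Vm y x w) t,
      forall x : Mp D, kapp x x = 0
    & [/\ forall (x z : Mp D) (y : Mm D),
            actp (kapp x z) y = Vp x y z - Vp z y x,
          forall (x z u : Mp D) (b : Jm D),
            actp (kapp x z) (actm b u) = Vp z (actm b x) u - Vp x (actm b z) u,
          forall (x z : Mp D) (y : Mm D) (b : Jm D),
            actm (kapm (actm b x) y) z = actm b (Vp x y z) + Vm y x (actm b z),
          forall (x z : Mp D) (a : Jp D) (b : Jm D),
            jD (@Qp k D) (kapp x z) b a =
            kapp (actp a (actm b x)) z + kapp x (actp a (actm b z))
        & (forall (a c : Jp D) (y w : Mm D),
            jD (@Qp k D) a (kapm y w) c =
            kapp (actp a w) (actp c y) + kapp (actp c w) (actp a y)) /\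
          (forall (x z u : Mp D) (y : Mm D),
            kapp (actp (kapp z u) y) x = kapp (Vp x y z) u + kapp z (Vp x y u))]].

Record jkpair := JKPair {
  jkd :> jkdata k;
  jkpair_jordan : jordan_pair (@Qp k jkd) (@Qm k jkd);
  jkpair_plus : jk_axioms jkd;
  jkpair_minus : jk_axioms (jkopp jkd)
}.

Record jkhom (P P' : jkpair) := JKHom {
  hJp : {linear Jp P -> Jp P'}; hJm : {linear Jm P -> Jm P'};
  hMp : {linear Mp P -> Mp P'}; hMm : {linear Mm P -> Mm P'};
  hom_Qp : forall a b, hJp (Qp a b) = Qp (hJp a) (hJm b);
  hom_Qm : forall b a, hJm (Qm b a) = Qm (hJm b) (hJp a);
  hom_actp : forall a y, hMp (actp a y) = actp (hJp a) (hMm y);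
  hom_actm : forall b x, hMm (actm b x) = actm (hJm b) (hMp x);
  hom_Vp : forall x y z, hMp (Vp x y z) = Vp (hMp x) (hMm y) (hMp z);
  hom_Vm : forall y x w, hMm (Vm y x w) = Vm (hMm y) (hMp x) (hMm w);
  hom_kapp : forall x z, hJp (kapp x z) = kapp (hMp x) (hMp z);
  hom_kapm : forall y w, hJm (kapm y w) = kapm (hMm y) (hMm w)
}.

Definition jkid (P : jkpair) : jkhom P P.
Proof.
by apply: (@JKHom P P [the {linear _ -> _} of idfun] [the {linear _ -> _} of idfun]
  [the {linear _ -> _} of idfun] [the {linear _ -> _} of idfun]).
Defined.

Definition jkcomp (P P' P'' : jkpair) (h' : jkhom P' P'') (h : jkhom P P') :
  jkhom P P''.
Proof.
apply: (@JKHom P P'' [the {linear _ -> _} of hJp h' \o hJp h]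
  [the {linear _ -> _} of hJm h' \o hJm h]
  [the {linear _ -> _} of hMp h' \o hMp h]
  [the {linear _ -> _} of hMm h' \o hMm h]) => /=.
- by move=> a b; rewrite !hom_Qp.
- by move=> b a; rewrite !hom_Qm.
- by move=> a y; rewrite !hom_actp.
- by move=> b x; rewrite !hom_actm.
- by move=> x y z; rewrite !hom_Vp.
- by move=> y x w; rewrite !hom_Vm.
- by move=> x z; rewrite !hom_kapp.
- by move=> y w; rewrite !hom_kapm.
Defined.

End JordanKantor.

Section Ider.
Variables (k : comPzRingType) (P : jkpair k).

(* P = J^- (+) M^- (+) M^+ (+) J^+ *)
Definition pmod : Type := (Jm P * Mm P * Mp P * Jp P)%type.
HB.instance Definition _ := GRing.Lmodule.on pmod.

Definition mkp (b : Jm P) (y : Mm P) (x : Mp P) (a : Jp P) : pmod :=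
  (b, y, x, a).
Definition prJm (p : pmod) : Jm P := p.1.1.1.
Definition prMm (p : pmod) : Mm P := p.1.1.2.
Definition prMp (p : pmod) : Mp P := p.1.2.
Definition prJp (p : pmod) : Jp P := p.2.

Definition der_delta (a : Jp P) (b : Jm P) : pmod -> pmod := fun p =>
  mkp (- jD (@Qm k P) b a (prJm p)) (- actm b (actp a (prMm p)))
      (actp a (actm b (prMp p))) (jD (@Qp k P) a b (prJp p)).

Definition der_v (x : Mp P) (y : Mm P) : pmod -> pmod := fun p =>
  mkp (- kapm (actm (prJm p) x) y) (- Vm y x (prMm p))
      (Vp x y (prMp p)) (kapp (actp (prJp p) y) x).

(* The generators are linear, so their span consists of linear maps. *)
Definition ider_gen : set (pmod -> pmod) := [set T |
  (exists a b, T = der_delta a b) \/ (exists x y, T = der_v x y)].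

Definition ider : Type := spanmod ider_gen.
HB.instance Definition _ := GRing.Lmodule.on ider.

Definition ider_fun (T : ider) : pmod -> pmod := spanmod_val T.

(* The commutator lies in the span, so that the default value 0 is not used. *)
Definition ider_br (S T : ider) : ider :=
  insubd (0 : spanmod ider_gen)
    (fun p => ider_fun S (ider_fun T p) - ider_fun T (ider_fun S p)).

Fact der_delta_ider a b : der_delta a b \in span ider_gen.
Proof. by apply: span_gen; left; exists a, b. Qed.

Fact der_v_ider x y : der_v x y \in span ider_gen.
Proof. by apply: span_gen; right; exists x, y. Qed.

Definition ider_delta a b : ider := Spanmod (der_delta_ider a b).
Definition ider_v x y : ider := Spanmod (der_v_ider x y).

End Ider.

Section Uider.
Variables (k : comPzRingType) (P : jkpair k).

Definition uider_pre : Type := (tens (Jp P) (Jm P) * tens (Mp P) (Mm P))%type.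
HB.instance Definition _ := GRing.Lmodule.on uider_pre.

Local Notation "a #J b" := ((tensor a b, 0) : uider_pre)
  (at level 40, b at level 39).
Local Notation "x #M y" := ((0, tensor x y) : uider_pre)
  (at level 40, y at level 39).
Local Notation Dp := (jD (@Qp k P)).
Local Notation Dm := (jD (@Qm k P)).

Inductive uider_rel : set uider_pre :=
| URel_M (x : Mp P) (y : Mm P) :
    uider_rel (x #M (Vm y x y) - (Vp x y x) #M y)
| URel_MM (x u : Mp P) (y w : Mm P) :
    uider_rel ((Vp x y u) #M w + (Vp u w x) #M y
               - u #M (Vm y x w) - x #M (Vm w u y))
| URel_J (a : Jp P) (b : Jm P) :
    uider_rel (a #J (Dm b a b) - (Dp a b a) #J b)
| URel_JJ (a c : Jp P) (b d : Jm P) :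
    uider_rel ((Dp a b c) #J d - c #J (Dm b a d)
               + (Dp c d a) #J b - a #J (Dm b c d))
| URel_kapp (x u : Mp P) (b : Jm P) :
    uider_rel ((kapp u x) #J b - x #M (actm b u) + u #M (actm b x))
| URel_kapm (a : Jp P) (y w : Mm P) :
    uider_rel (a #J (kapm y w) - (actp a y) #M w + (actp a w) #M y).

Definition uider : Type := quotmod uider_rel.
HB.instance Definition _ := GRing.Lmodule.on uider.

Definition diaJ (a : Jp P) (b : Jm P) : uider := qpi uider_rel (a #J b).
Definition diaM (x : Mp P) (y : Mm P) : uider := qpi uider_rel (x #M y).

(* The map on uider determined by a <> b |-> f a b, x <> y |-> g x y; it is  *)
(* defined through representatives, and is that linear map whenever f and g *)
(* respect the relations, see uider_liftP.                                  *)
Definition uider_lift (W : lmodType k)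
    (f : Jp P -> Jm P -> W) (g : Mp P -> Mm P -> W) : uider -> W :=
  @qlift k _ uider_rel W (fun t : uider_pre => tlift f t.1 + tlift g t.2).

Lemma uider_liftP (W : lmodType k)
    (f : Jp P -> Jm P -> W) (g : Mp P -> Mm P -> W) :
  is_bilinear f -> is_bilinear g ->
  (forall t, uider_rel t -> tlift f t.1 + tlift g t.2 = 0) ->
  [/\ is_linear (uider_lift f g),
      forall a b, uider_lift f g (diaJ a b) = f a b
    & forall x y, uider_lift f g (diaM x y) = g x y].
Proof.
move=> bf bg rel0; have lf := tlift_is_linear bf; have lg := tlift_is_linear bg.
have z0 (A : lmodType k) (h : A -> W) : is_linear h -> h 0 = 0.
  by move=> lh; have := lh (-1) 0 0; rewrite scaler0 addr0 scaleN1r addNr.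
have lfg : is_linear (fun t : uider_pre => tlift f t.1 + tlift g t.2).
  by move=> c u v /=; rewrite lf lg scalerDr addrACA.
split; first exact: (qlift_is_linear lfg rel0).
- move=> a b; rewrite /uider_lift (qlift_qpi lfg rel0) /= tlift_tensor //.
  by rewrite (z0 _ _ lg) addr0.
- move=> x y; rewrite /uider_lift (qlift_qpi lfg rel0) /= tlift_tensor //.
  by rewrite (z0 _ _ lf) add0r.
Qed.

Definition ud : uider -> ider P := uider_lift (@ider_delta k P) (@ider_v k P).

Definition onJp (T : ider P) (a : Jp P) : Jp P := prJp (ider_fun T (mkp 0 0 0 a)).
Definition onJm (T : ider P) (b : Jm P) : Jm P := prJm (ider_fun T (mkp b 0 0 0)).
Definition onMp (T : ider P) (x : Mp P) : Mp P := prMp (ider_fun T (mkp 0 0 x 0)).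
Definition onMm (T : ider P) (y : Mm P) : Mm P := prMm (ider_fun T (mkp 0 y 0 0)).

Definition uider_act (T : ider P) : uider -> uider :=
  uider_lift (fun a b => diaJ (onJp T a) b + diaJ a (onJm T b))
             (fun x y => diaM (onMp T x) y + diaM x (onMm T y)).

Definition uider_br (p q : uider) : uider := uider_act (ud p) q.

End Uider.

Definition uider_map (k : comPzRingType) (P Q : jkpair k) (h : jkhom P Q) :
    uider P -> uider Q :=
  uider_lift (fun a b => diaJ (hJp h a) (hJm h b))
             (fun x y => diaM (hMp h x) (hMm h y)).

Section LieAlgebras.
Variable k : comPzRingType.

Definition is_lie (L : lmodType k) (br : L -> L -> L) : Prop :=
  [/\ is_bilinear br, forall x, br x x = 0
    & forall x y z, br x (br y z) + br y (br z x) + br z (br x y) = 0].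

Section Hom.
Variables (L L' : lmodType k) (br : L -> L -> L) (br' : L' -> L' -> L').

Definition lie_hom (f : L -> L') : Prop :=
  is_linear f /\ forall x y, f (br x y) = br' (f x) (f y).

Definition central_extension (f : L -> L') : Prop :=
  [/\ lie_hom f, forall y, exists x, f x = y
    & forall x, f x = 0 -> forall y, br x y = 0].

End Hom.

(* br is graded by the Z-indexed family C of submodules with direct sum L. *)
Definition is_graded (L : lmodType k) (br : L -> L -> L) (C : int -> set L) :
    Prop :=
  [/\ forall i, submodule (C i),
      forall x, exists (s : seq int) (c : int -> L),
        (forall i, C i (c i)) /\ x = \sum_(i <- s) c i,
      forall (s : seq int) (c : int -> L), uniq s -> (forall i, C i (c i)) ->
        \sum_(i <- s) c i = 0 -> forall i, i \in s -> c i = 0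
    & forall i j x y, C i x -> C j y -> C (i + j) (br x y)].

Definition five_graded_lie (L : lmodType k) (br : L -> L -> L)
    (C : int -> set L) : Prop :=
  [/\ is_lie br, is_graded br C
    & forall i : int, (2 < `|i|)%N -> C i `<=` [set 0]].

Definition graded_central_extension (L L' : lmodType k)
    (br : L -> L -> L) (C : int -> set L)
    (br' : L' -> L' -> L') (C' : int -> set L') (f : L -> L') : Prop :=
  [/\ five_graded_lie br C, five_graded_lie br' C', central_extension br br' f
    & forall i x, C i x -> C' i (f x)].

End LieAlgebras.

Section LHat.
Variables (k : comPzRingType) (P : jkpair k) (D0 : lmodType k).

Definition lhat : Type := (pmod P * D0)%type.
HB.instance Definition _ := GRing.Lmodule.on lhat.

Definition lhat_deg (i : int) : set lhat := fun z =>
  if i == 2 then exists a, z = (mkp 0 0 0 a, 0)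
  else if i == 1 then exists x, z = (mkp 0 0 x 0, 0)
  else if i == 0 then exists X, z = (0, X)
  else if i == -1 then exists y, z = (mkp 0 y 0 0, 0)
  else if i == -2 then exists b, z = (mkp b 0 0 0, 0)
  else z = 0.

Variables (br0 : D0 -> D0 -> D0) (f : uider P -> D0) (g : D0 -> ider P).

(* [(a, x), (b, y)] *)
Definition lhat_pm (a : Jp P) (x : Mp P) (b : Jm P) (y : Mm P) : lhat :=
  (mkp 0 (- actm b x) (actp a y) 0, f (diaJ a b) + f (diaM x y)).

Definition lhat_br (z z' : lhat) : lhat :=
  let: (p, X) := z in let: (p', X') := z' in
  (mkp (kapm (prMm p) (prMm p')) 0 0 (kapp (prMp p) (prMp p')), 0)
  + lhat_pm (prJp p) (prMp p) (prJm p') (prMm p')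
  - lhat_pm (prJp p') (prMp p') (prJm p) (prMm p)
  + (ider_fun (g X) p' - ider_fun (g X') p, br0 X X').

End LHat.

Section TkkUle.
Variable k : comPzRingType.

Definition TKK (P : jkpair k) : Type := lhat P (ider P).
HB.instance Definition _ P := GRing.Lmodule.on (TKK P).

Definition TKK_br (P : jkpair k) : TKK P -> TKK P -> TKK P :=
  lhat_br (@ider_br k P) (@ud k P) idfun.

Definition ULE (P : jkpair k) : Type := lhat P (uider P).
HB.instance Definition _ P := GRing.Lmodule.on (ULE P).

Definition ULE_br (P : jkpair k) : ULE P -> ULE P -> ULE P :=
  lhat_br (@uider_br k P) idfun (@ud k P).

Definition pmod_map (P Q : jkpair k) (h : jkhom P Q) (p : pmod P) : pmod Q :=
  mkp (hJm h (prJm p)) (hMm h (prMm p)) (hMp h (prMp p)) (hJp h (prJp p)).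

Definition ULE_map (P Q : jkpair k) (h : jkhom P Q) (z : ULE P) : ULE Q :=
  (pmod_map h z.1, uider_map h z.2).

End TkkUle.

(* Main.v *)
(** The proof rests on two facts. First, every element of ider P acts on P by
    derivations of all the products: for delta(a,b) and v(x,y) this is a
    reformulation of the axioms (for delta(a,b) on J it is the five-linear
    identity of Jordan pairs). Hence
    [T, delta(a,b)] = delta(Ta,b) + delta(a,Tb), and similarly for v, so that ider P is a
    Lie algebra, and the relations I(P) say that p.q + q.p = 0 and that
    kappa is compatible with the diamond products, so they are annihilated by ud
    and preserved by derivations.
    Secondly, since f is onto, [X, f p] = f (g(X).p), and each component of the
    Jacobi identity of P + D0 reduces to such derivation rules. As P generates
    P + D0, a homomorphism is determined by its restriction to P. *)

Require Import Defs.
From HB Require Import structures.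
From mathcomp Require Import all_boot all_algebra.
From mathcomp Require Import boolp classical_sets functions.

Set Implicit Arguments.
Unset Strict Implicit.
Unset Printing Implicit Defensive.

Import GRing.Theory.

Local Open Scope ring_scope.

(** * Identities in abelian groups *)

(** Three things shape the proof. The signs + and - are interchangeable, except that delta(a,b) and
    v(x,y) turn into the negatives of the generators of the opposite pair. Rules are therefore
    proved for values in J^+ and M^+ and then transferred, with a sign change for the generators.
    Finally, ULE(P), the algebra over D0 and TKK(P) are one construction for three choices of the
    degree 0 part. What is needed of that part is collected in [ider_cover], so (i) is proved once,
    and both halves of (ii) are one statement about a map between two such covers. The computations
    end in identities between sums of signed terms. They are decided by counting coefficients of
    syntactically equal atoms, which is why some operations are locked and why symmetric products
    are first put into a fixed order. *)

Inductive zexpr := ZVar of nat | ZZero | ZAdd of zexpr & zexpr | ZOpp of zexpr.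

Fixpoint zeval (V : zmodType) (env : seq V) (e : zexpr) : V :=
  match e with
  | ZVar i => nth 0 env i
  | ZZero => 0
  | ZAdd e1 e2 => zeval env e1 + zeval env e2
  | ZOpp e1 => - zeval env e1
  end.

Fixpoint zcoef (e : zexpr) (i : nat) : int :=
  match e with
  | ZVar j => if i == j then 1%Z else 0%Z
  | ZZero => 0%Z
  | ZAdd e1 e2 => zcoef e1 i + zcoef e2 i
  | ZOpp e1 => - zcoef e1 i
  end.

Lemma zeval_coef (V : zmodType) (env : seq V) e :
  zeval env e = \sum_(i < size env) nth 0 env i *~ zcoef e i.
Proof.
elim: e => [j||e1 IH1 e2 IH2|e1 IH1] /=.
- have [ltj|lej] := ltnP j (size env).
    rewrite (bigD1 (Ordinal ltj)) //= eqxx big1 ?addr0 // => i.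
    by rewrite -val_eqE /= => /negPf ->.
  rewrite nth_default // big1 // => i _; case: eqP => // eij.
  by rewrite -eij leqNgt ltn_ord in lej.
- by rewrite big1.
- by rewrite IH1 IH2 -big_split; apply: eq_bigr => i _; rewrite mulrzDr.
- by rewrite IH1 -sumrN; apply: eq_bigr => i _; rewrite mulrNz.
Qed.

(** Both sides are the same integer combination of the atoms in [env]. The check on coefficients is
    a closed boolean, evaluated by [vm_compute]; it regards distinct atoms as independent, so it
    succeeds only on formal consequences of the abelian group laws. *)
Lemma zmod_eq (V : zmodType) (env : seq V) n e1 e2 :
  size env = n -> all (fun i => zcoef e1 i == zcoef e2 i) (iota 0 n) ->
  zeval env e1 = zeval env e2.
Proof.
move=> <- /allP e12; rewrite !zeval_coef; apply: eq_bigr => i _.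
by rewrite (eqP (e12 i _)) // mem_iota /=.
Qed.

Ltac zfind x env n :=
  lazymatch env with
  | nil => constr:(@None nat)
  | cons ?y ?env' =>
    match goal with
    | _ => let _ := match goal with _ => constr_eq x y end in constr:(Some n)
    | _ => zfind x env' (S n)
    end
  end.

Ltac zlength env :=
  lazymatch env with
  | nil => constr:(O)
  | cons _ ?env' => let n := zlength env' in constr:(S n)
  end.

Ltac zatoms t env :=
  lazymatch t with
  | @GRing.add _ ?a ?b => let env := zatoms a env in zatoms b env
  | @GRing.opp _ ?a => zatoms a env
  | @GRing.zero _ => env
  | _ => let r := zfind t env O in
         lazymatch r with None => constr:(cons t env) | _ => env end
  end.

Ltac zreify t env :=
  lazymatch t with
  | @GRing.add _ ?a ?b =>
    let a := zreify a env in let b := zreify b env in constr:(ZAdd a b)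
  | @GRing.opp _ ?a => let a := zreify a env in constr:(ZOpp a)
  | @GRing.zero _ => constr:(ZZero)
  | _ => lazymatch zfind t env O with Some ?n => constr:(ZVar n) end
  end.

Ltac zmod :=
  lazymatch goal with
  | |- @eq ?T ?a ?b =>
    let env := zatoms a (@nil T) in
    let env := zatoms b env in
    let ea := zreify a env in
    let eb := zreify b env in
    let n := zlength env in
    refine (@zmod_eq _ env n ea eb (erefl n) _); vm_compute; reflexivity
  end.

(* [zlc (zadd e1 (zsub e2 e3))] proves an equation that is the indicated
   combination of the equations e1, e2, e3 *)
Lemma zlcP (V : zmodType) (a b c d : V) : c = d -> a - b = c - d -> a = b.
Proof. by move=> -> /eqP; rewrite subrr subr_eq0 => /eqP. Qed.

Lemma zadd (V : zmodType) (a b c d : V) : a = b -> c = d -> a + c = b + d.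
Proof. by move=> -> ->. Qed.

Lemma zsub (V : zmodType) (a b c d : V) : a = b -> c = d -> a - c = b - d.
Proof. by move=> -> ->. Qed.

Lemma zopp (V : zmodType) (a b : V) : a = b -> - a = - b.
Proof. by move=> ->. Qed.

Ltac zlc H := apply: (zlcP H); zmod.

(** * Linear and bilinear maps *)

Section Linear.
Variables (k : pzRingType) (U V : lmodType k).
Variables (f : U -> V) (H : is_linear f).

Lemma linD u v : f (u + v) = f u + f v.
Proof. by have := H 1 u v; rewrite !scale1r. Qed.

Lemma lin0 : f 0 = 0.
Proof. by apply: (addIr (f 0)); rewrite -linD !add0r. Qed.

Lemma linZ c u : f (c *: u) = c *: f u.
Proof. by rewrite -[c *: u]addr0 H lin0 addr0. Qed.

Lemma linN u : f (- u) = - f u.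
Proof. by rewrite -!scaleN1r linZ. Qed.

Definition linE := (linD, lin0, linN, linZ).
End Linear.

Section Bilinear.
Variables (k : pzRingType) (U V W : lmodType k).
Variables (f : U -> V -> W) (H : is_bilinear f).

Lemma bilDl u v w : f (u + v) w = f u w + f v w. Proof. exact: (linD (H.2 w)). Qed.
Lemma bilDr u v w : f u (v + w) = f u v + f u w. Proof. exact: (linD (H.1 u)). Qed.
Lemma bil0l w : f 0 w = 0. Proof. exact: (lin0 (H.2 w)). Qed.
Lemma bil0r u : f u 0 = 0. Proof. exact: (lin0 (H.1 u)). Qed.
Lemma bilNl u w : f (- u) w = - f u w. Proof. exact: (linN (H.2 w)). Qed.
Lemma bilNr u w : f u (- w) = - f u w. Proof. exact: (linN (H.1 u)). Qed.
Lemma bilZl c u w : f (c *: u) w = c *: f u w. Proof. exact: (linZ (H.2 w)). Qed.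
Lemma bilZr c u w : f u (c *: w) = c *: f u w. Proof. exact: (linZ (H.1 u)). Qed.

Definition bilE := (bilDl, bilDr, bil0l, bil0r, bilNl, bilNr, bilZl, bilZr).
End Bilinear.

(** * Jordan pairs *)

Section RegularAlgebra.
Variables (k : comPzRingType) (k10 : (1 : k) != 0).

(** The alias depends on a proof of [1 != 0] because a [comAlgType] is nonzero, whereas [k] itself
    may be the zero ring. *)
Definition regular_alg of (1 : k) != 0 : Type := k^o.

HB.instance Definition _ := GRing.ComPzRing.on (regular_alg k10).
HB.instance Definition _ := GRing.Lmodule.on (regular_alg k10).
HB.instance Definition _ :=
  GRing.PzSemiRing_isNonZero.Build (regular_alg k10) k10.
HB.instance Definition _ :=
  GRing.LSemiModule_isLSemiAlgebra.Build k (regular_alg k10) (@mulrA k).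
HB.instance Definition _ :=
  GRing.LSemiAlgebra_isComSemiAlgebra.Build k (regular_alg k10).

End RegularAlgebra.

Lemma exists_alg_retract (k : comPzRingType) :
  (1 : k) <> 0 -> exists K : comAlgType k, exists e : K -> k^o,
    is_linear e /\ e 1 = 1.
Proof.
by move=> /eqP k10; exists (regular_alg k10 : comAlgType k), id.
Qed.

(** The contraction of a tensor of [s] and [v] to [e s *: v] is a left inverse. *)
Lemma bc_tensor_inj (k : comPzRingType) (K : comAlgType k) (e : K -> k^o)
    (V : lmodType k) :
  is_linear e -> e 1 = 1 -> injective (bc_tensor (1 : K) : V -> base_change K V).
Proof.
move=> le e1 u v.
have bil : is_bilinear (fun (s : K) (v : V) => (e s : k) *: v).
  split=> [s|w] c x y /=; first by rewrite scalerDr !scalerA mulrC.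
  by rewrite le scalerDl scalerA.
move=> /(congr1 (tlift (fun (s : K) (v : V) => (e s : k) *: v))).
by rewrite !(tlift_tensor bil) e1 !scale1r.
Qed.

(** The axiom yields identities only on scalar extensions. Taking [K] to be [k] itself, they descend
    along the injection of a module into its extension; if [1 = 0] in [k], every module is
    trivial. *)
Lemma jordan_pair_identities (k : comPzRingType) (U V : lmodType k)
    (Q : U -> V -> U) (Q' : V -> U -> V) :
  jordan_pair Q Q' -> jordan_identities Q Q' /\ jordan_identities Q' Q.
Proof.
move=> [_ _ JK]; have [k10|/exists_alg_retract [K [e [le e1]]]] := pselect ((1 : k) = 0).
  have triv (W : lmodType k) (u v : W) : u = v.
    by rewrite -[u]scale1r -[v]scale1r k10 !scale0r.
  by split=> a b; split=> *; apply: triv.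
have [QK [QK' [_ EQ EQ' JQ JQ']]] := JK K.
have bcD (W : lmodType k) (u v : W) :
    bc_tensor (1 : K) u + bc_tensor 1 v = bc_tensor 1 (u + v).
  by rewrite /bc_tensor (bilDr (tensor_is_bilinear K W)).
have bcN (W : lmodType k) (u : W) : - bc_tensor (1 : K) u = bc_tensor 1 (- u).
  by rewrite /bc_tensor (bilNr (tensor_is_bilinear K W)).
have ED a b c : jD QK (bc_tensor 1 a) (bc_tensor 1 b) (bc_tensor 1 c) =
    bc_tensor 1 (jD Q a b c).
  by rewrite /jD /polar bcD !EQ !bcN !bcD.
have ED' a b c : jD QK' (bc_tensor 1 a) (bc_tensor 1 b) (bc_tensor 1 c) =
    bc_tensor 1 (jD Q' a b c).
  by rewrite /jD /polar bcD !EQ' !bcN !bcD.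
split=> a b; split=> c; apply: (bc_tensor_inj le e1).
- by have [H _ _] := JQ (bc_tensor 1 a) (bc_tensor 1 b);
    have := H (bc_tensor 1 c); rewrite !(EQ, EQ', ED, ED').
- by have [_ H _] := JQ (bc_tensor 1 a) (bc_tensor 1 b);
    have := H (bc_tensor 1 c); rewrite !(EQ, EQ', ED, ED').
- by have [_ _ H] := JQ (bc_tensor 1 a) (bc_tensor 1 b);
    have := H (bc_tensor 1 c); rewrite !(EQ, EQ', ED, ED').
- by have [H _ _] := JQ' (bc_tensor 1 a) (bc_tensor 1 b);
    have := H (bc_tensor 1 c); rewrite !(EQ, EQ', ED, ED').
- by have [_ H _] := JQ' (bc_tensor 1 a) (bc_tensor 1 b);
    have := H (bc_tensor 1 c); rewrite !(EQ, EQ', ED, ED').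
- by have [_ _ H] := JQ' (bc_tensor 1 a) (bc_tensor 1 b);
    have := H (bc_tensor 1 c); rewrite !(EQ, EQ', ED, ED').
Qed.

Lemma quadratic_jD (k : comPzRingType) (W W' : lmodType k) (q : W -> W' -> W) :
  is_quadratic_hom q ->
  [/\ forall b, is_bilinear (fun a c => jD q a b c),
      forall a c, is_linear (fun b => jD q a b c)
    & forall a b c, jD q a b c = jD q c b a].
Proof.
move=> [lq qq]; split.
- by move=> b; have [] := qq b.
- move=> a c s u v; rewrite /jD /polar /= !lq !scalerBr; zmod.
- by move=> a b c; rewrite /jD /polar /= (addrC a c) addrAC.
Qed.

Section JordanTriple.
Variables (k : comPzRingType) (U V : lmodType k).
Variables (Q : U -> V -> U) (Q' : V -> U -> V).
Hypotheses (qQ : is_quadratic_hom Q) (qQ' : is_quadratic_hom Q').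
Hypotheses (JQ : jordan_identities Q Q').

(* [jD] unfolds to a sum, on which rewriting by additivity would loop. *)
Variables (D : U -> V -> U -> U) (D' : V -> U -> V -> V).
Hypotheses (DE : D = jD Q) (DE' : D' = jD Q').

Let QD a c b : Q (a + c) b = Q a b + Q c b + D a b c.
Proof. rewrite DE /jD /polar /=; zmod. Qed.

Let Dbil b : is_bilinear (fun a c => D a b c).
Proof. by rewrite DE; have [] := quadratic_jD qQ. Qed.
Let Dlin a c : is_linear (fun b => D a b c).
Proof. by rewrite DE; have [] := quadratic_jD qQ. Qed.
Let D'lin a c : is_linear (fun b => D' a b c).
Proof. by rewrite DE'; have [] := quadratic_jD qQ'. Qed.
Let DDl a c b d : D (a + c) b d = D a b d + D c b d. Proof. exact: (bilDl (Dbil b)). Qed.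
Let DDr a c b d : D d b (a + c) = D d b a + D d b c. Proof. exact: (bilDr (Dbil b)). Qed.
Let DDm a c b d : D a (b + d) c = D a b c + D a d c. Proof. exact: (linD (Dlin a c)). Qed.
Let D'Dm a c b d : D' b (a + c) d = D' b a d + D' b c d. Proof. exact: (linD (D'lin b d)). Qed.
Let QDr a b d : Q a (b + d) = Q a b + Q a d. Proof. exact: (linD (qQ.1 a)). Qed.
Let DC a b c : D a b c = D c b a.
Proof. by rewrite DE; have [_ _ H] := quadratic_jD qQ; apply: H. Qed.
Let Q'Dl a c b : Q' (a + c) b = Q' a b + Q' c b + D' a b c.
Proof. rewrite DE' /jD /polar /=; zmod. Qed.

(* As alternating sums of instances over k, the full polarizations below need no
   scalar extension. *)
Let JP1 x w u y z :
  D x y (D w z u) + D w y (D x z u) + D u y (D x z w) =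
  D x (D' y u z) w + D x (D' y w z) u + D w (D' y x z) u.
Proof.
have F a : D a y (Q a z) = Q a (D' y a z) by rewrite ?DE ?DE'; have [] := JQ a y.
have E := zadd (zsub (zsub (zsub (F (x + w + u)) (F (x + w))) (F (x + u)))
  (F (w + u))) (zadd (F x) (zadd (F w) (F u))).
rewrite !(QD, QDr, DDl, DDr, DDm, D'Dm) in E.
zlc E.
Qed.

Let JP2 x w y v u :
  D (D x y w) v u + D (D x v w) y u = D x (D' y w v) u + D w (D' y x v) u.
Proof.
have F a b : D (Q a b) b u = D a (Q' b a) u by rewrite ?DE ?DE'; have [] := JQ a b.
have G a : D (Q a y) v u + D (Q a v) y u = D a (D' y a v) u.
  have E := zsub (F a (y + v)) (zadd (F a y) (F a v)).
  rewrite !(QDr, Q'Dl, DDl, DDr, DDm, D'Dm) in E.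
  zlc E.
have E := zsub (G (x + w)) (zadd (G x) (G w)).
rewrite !(QD, QDr, DDl, DDr, DDm, D'Dm) in E.
zlc E.
Qed.

(* The difference of the full polarizations of the first two Jordan pair
   identities. *)
Let JP12 x w u y z :
  D x y (D w z u) + D w y (D x z u) - D (D x y w) z u = D x (D' y u z) w.
Proof.
have E := zsub (JP1 x w u y z) (JP2 x w y z u).
rewrite (DC u y) in E; zlc E.
Qed.

(** [JP12] has the terms [- D c b (D a d e) + D a (D' b e d) c] where the derivation rule has its
    last two corrections. Exchanging [c] and [e] in [JP1] and [JP12] and subtracting ([E2]) shows
    that, up to the symmetry of [D], these are the same. *)
Lemma jordan_derivation a b c d e :
  D a b (D c d e) = D (D a b c) d e - D c (D' b a d) e + D c d (D a b e).
Proof.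
have E := JP12 a c e b d.
have E2 := zsub (JP1 a e c b d) (JP12 a e c b d).
rewrite (DC c d (D a b e)).
rewrite ?(DC e _ c) in E2.
zlc (zsub E E2).
Qed.

End JordanTriple.

(** * Jordan-Kantor pairs *)

(** Used to obtain every identity with values in J^- or M^- from its counterpart by conversion
    alone. The axioms mention the data only through projections, so those of the double opposite
    reduce to the original ones. *)
Definition jkpair_opp (k : comPzRingType) (P : jkpair k) : jkpair k :=
  @JKPair k (jkopp P)
    (let: And3 q q' J := jkpair_jordan P in
     And3 q' q (fun K => let: ex_intro QK (ex_intro QK' (And5 q E E' J1 J2)) := J K in
       ex_intro _ QK' (ex_intro _ QK (And5 (conj q.2 q.1) E' E J2 J1))))
    (jkpair_minus P) (jkpair_plus P).

(* Locked, so that rewriting by additivity does not unfold the polarization. *)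
Definition trp (k : comPzRingType) (P : jkpair k) : Jp P -> Jm P -> Jp P -> Jp P :=
  locked (jD (@Qp k P)).
Definition trm (k : comPzRingType) (P : jkpair k) : Jm P -> Jp P -> Jm P -> Jm P :=
  locked (jD (@Qm k P)).

Section Identities.
Variables (k : comPzRingType) (P : jkpair k).

Lemma trpE : jD (@Qp k P) = @trp k P. Proof. exact: lock. Qed.
Lemma trmE : jD (@Qm k P) = @trm k P. Proof. exact: lock. Qed.

Lemma actp_bil : is_bilinear (@actp k P).
Proof. by have [[]] := jkpair_plus P. Qed.
Lemma Vp_bil z : is_bilinear (fun x y => @Vp k P x y z).
Proof. by have [[]] := jkpair_plus P. Qed.
Lemma Vp_lin x y : is_linear (@Vp k P x y).
Proof. by have [[]] := jkpair_plus P. Qed.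
Lemma kapp_bil : is_bilinear (@kapp k P).
Proof. by have [[]] := jkpair_plus P. Qed.
Lemma trp_bil b : is_bilinear (fun a c => @trp k P a b c).
Proof.
by rewrite -trpE; have [q _ _] := jkpair_jordan P; have [] := quadratic_jD q.
Qed.
Lemma trp_lin a c : is_linear (fun b => @trp k P a b c).
Proof.
by rewrite -trpE; have [q _ _] := jkpair_jordan P; have [] := quadratic_jD q.
Qed.

Lemma trpC (a c : Jp P) b : trp a b c = trp c b a.
Proof.
rewrite -trpE; have [q _ _] := jkpair_jordan P.
by have [_ _ H] := quadratic_jD q; apply: H.
Qed.
Lemma trp_der (a c e : Jp P) (b d : Jm P) :
  trp a b (trp c d e) = trp (trp a b c) d e - trp c (trm b a d) e + trp c d (trp a b e).
Proof.
have [q q' _] := jkpair_jordan P; have [J _] := jordan_pair_identities (jkpair_jordan P).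
by apply: (jordan_derivation q q' J); rewrite ?trpE ?trmE.
Qed.
Lemma actp_tr (a c : Jp P) (b : Jm P) (y : Mm P) :
  actp (trp a b c) y = actp a (actm b (actp c y)) + actp c (actm b (actp a y)).
Proof. by rewrite -trpE; have [] := jkpair_plus P. Qed.
Lemma Vp_der (x z t : Mp P) (y w : Mm P) :
  Vp x y (Vp z w t) = Vp (Vp x y z) w t - Vp z (Vm y x w) t + Vp z w (Vp x y t).
Proof. have [_ _ H _ _] := jkpair_plus P; zlc (H x z t y w). Qed.
Lemma kappxx (x : Mp P) : kapp x x = 0.
Proof. by have [] := jkpair_plus P. Qed.
Lemma kappC (x z : Mp P) : kapp x z = - kapp z x.
Proof.
have := kappxx (x + z); rewrite !(bilE kapp_bil) !kappxx => E; zlc E.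
Qed.
Lemma kapp_act (x z : Mp P) (y : Mm P) : actp (kapp x z) y = Vp x y z - Vp z y x.
Proof. by have [_ _ _ _ []] := jkpair_plus P. Qed.
Lemma kapp_actact (x z u : Mp P) (b : Jm P) :
  actp (kapp x z) (actm b u) = Vp z (actm b x) u - Vp x (actm b z) u.
Proof. by have [_ _ _ _ []] := jkpair_plus P. Qed.
(** The axiom for kappa(b o x, y) o z in the opposite pair, solved for the term in which an element
    of J acts on a triple product, so that rewriting pushes that action inwards. *)
Lemma actp_V (x w : Mm P) (y : Mp P) (b : Jp P) :
  actp b (Vm x y w) = actp (kapp (actp b x) y) w - Vp y x (actp b w).
Proof.
have [_ _ _ _ [_ _ H _ _]] := jkpair_minus P.
have E : actp (kapp (actp b x) y) w = actp b (Vm x y w) + Vp y x (actp b w).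
  exact: H.
zlc (zopp E).
Qed.
Lemma trp_kapp (x z : Mp P) (a : Jp P) (b : Jm P) :
  trp (kapp x z) b a = kapp (actp a (actm b x)) z + kapp x (actp a (actm b z)).
Proof. by rewrite -trpE; have [_ _ _ _ []] := jkpair_plus P. Qed.
Lemma trp_kapm (a c : Jp P) (y w : Mm P) :
  trp a (kapm y w) c = kapp (actp a w) (actp c y) + kapp (actp c w) (actp a y).
Proof. by rewrite -trpE; have [_ _ _ _ [_ _ _ _ []]] := jkpair_plus P. Qed.
Lemma kapp_kapp (x z u : Mp P) (y : Mm P) :
  kapp (actp (kapp z u) y) x = kapp (Vp x y z) u + kapp z (Vp x y u).
Proof. by have [_ _ _ _ [_ _ _ _ []]] := jkpair_plus P. Qed.

End Identities.

(** * Inner derivations of a Jordan-Kantor pair *)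

Section Derivations.
Variables (k : comPzRingType).

Local Notation opp P := (jkpair_opp P).

Section Opp.
Variable P : jkpair k.
Lemma actm_bil : is_bilinear (@actm k P). Proof. exact: (actp_bil (opp P)). Qed.
Lemma Vm_bil z : is_bilinear (fun x y => @Vm k P x y z).
Proof. exact: (Vp_bil (P := opp P)). Qed.
Lemma Vm_lin x y : is_linear (@Vm k P x y). Proof. exact: (Vp_lin (P := opp P)). Qed.
Lemma kapm_bil : is_bilinear (@kapm k P). Proof. exact: (kapp_bil (opp P)). Qed.
Lemma trm_bil b : is_bilinear (fun a c => @trm k P a b c).
Proof. exact: (trp_bil (P := opp P)). Qed.
Lemma trm_lin a c : is_linear (fun b => @trm k P a b c).
Proof. exact: (trp_lin (P := opp P)). Qed.
Lemma trmC (a c : Jm P) b : trm a b c = trm c b a.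
Proof. exact: (@trpC _ (opp P)). Qed.
Lemma kapmC (x z : Mm P) : kapm x z = - kapm z x.
Proof. exact: (@kappC _ (opp P)). Qed.
Lemma kapmxx (x : Mm P) : kapm x x = 0.
Proof. exact: (@kappxx _ (opp P)). Qed.
Lemma kapm_act (x z : Mm P) (y : Mp P) : actm (kapm x z) y = Vm x y z - Vm z y x.
Proof. exact: (@kapp_act _ (opp P)). Qed.
Lemma kapm_actact (x z u : Mm P) (b : Jp P) :
  actm (kapm x z) (actp b u) = Vm z (actp b x) u - Vm x (actp b z) u.
Proof. exact: (@kapp_actact _ (opp P)). Qed.
Lemma actm_V (x w : Mp P) (y : Mm P) (b : Jm P) :
  actm b (Vp x y w) = actm (kapm (actm b x) y) w - Vm y x (actm b w).
Proof. exact: (@actp_V _ (opp P)). Qed.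
Lemma trm_kapm (x z : Mm P) (a : Jm P) (b : Jp P) :
  trm (kapm x z) b a = kapm (actm a (actp b x)) z + kapm x (actm a (actp b z)).
Proof. exact: (@trp_kapp _ (opp P)). Qed.
Lemma trm_kapp (a c : Jm P) (y w : Mp P) :
  trm a (kapp y w) c = kapm (actm a w) (actm c y) + kapm (actm c w) (actm a y).
Proof. exact: (@trp_kapm _ (opp P)). Qed.

Definition opE := (bilE (actp_bil P), bilE (actm_bil), bilE (kapp_bil P), bilE kapm_bil,
  fun (x : Mp P) y => linE (Vp_lin x y), fun x y => linE (Vm_lin x y),
  fun z : Mp P => bilE (Vp_bil z), fun z => bilE (Vm_bil z),
  fun b : Jm P => bilE (trp_bil b), fun b => bilE (trm_bil b)).

(** Expanding kappa(w,y) o z by [kapm_act] and moving [a] inside each triple product leaves four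
    unwanted terms, which cancel in pairs. The result is the relation of I(P) for a (x) kappa(w,y),
    read on M^+. *)
Lemma act_kapm (a : Jp P) (w y : Mm P) (z : Mp P) :
  actp a (actm (kapm w y) z) = Vp (actp a w) y z - Vp (actp a y) w z.
Proof. rewrite kapm_act !opE !actp_V !kapp_act; zmod. Qed.
End Opp.

Lemma act_kapp (P : jkpair k) (a : Jm P) (w y : Mp P) (z : Mm P) :
  actm a (actp (kapp w y) z) = Vm (actm a w) y z - Vm (actm a y) w z.
Proof. exact: (@act_kapm (opp P)). Qed.

(* The product rules with values in J^+ and M^+; those with values in J^- and M^-
   are the same rules for the opposite pair. *)
Definition half_der (P : jkpair k) (tj : Jp P -> Jp P) (tj' : Jm P -> Jm P)
    (tm : Mp P -> Mp P) (tm' : Mm P -> Mm P) : Prop :=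
  [/\ is_linear tj /\ is_linear tm,
      forall a b c, tj (trp a b c) =
        trp (tj a) b c + trp a (tj' b) c + trp a b (tj c),
      forall a y, tm (actp a y) = actp (tj a) y + actp a (tm' y),
      forall x y z, tm (Vp x y z) = Vp (tm x) y z + Vp x (tm' y) z + Vp x y (tm z)
    & forall x z, tj (kapp x z) = kapp (tm x) z + kapp x (tm z)].

Lemma half_der_delta (P : jkpair k) (a : Jp P) (b : Jm P) :
  half_der (trp a b) (fun d => - trm b a d) (fun x => actp a (actm b x))
           (fun w => - actm b (actp a w)).
Proof.
split.
- by split=> c u v; rewrite !opE.
- move=> c d e; rewrite trp_der (linN (trp_lin c e)); zmod.
- move=> c y; rewrite actp_tr !opE; zmod.
(* First [b], then [a] is pushed into the triple product; the two copies of {a o y, b o x, z} that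
   arise have opposite signs. *)
- move=> x y z; rewrite actm_V !opE act_kapm actp_V kapp_actact; zmod.
- by move=> x z; rewrite trpC trp_kapp.
Qed.

Lemma half_der_v (P : jkpair k) (x : Mp P) (y : Mm P) :
  half_der (fun c => kapp (actp c y) x) (fun d => - kapm (actm d x) y)
           (Vp x y) (fun w => - Vm y x w).
Proof.
split.
- by split=> c u v; rewrite !opE.
(* The outer products contribute the cross terms kappa(a o y, c o (b o x)) and kappa(c o y, a o (b o
   x)); the middle one, containing - kappa(b o x, y), removes exactly these. *)
- move=> a b c; rewrite actp_tr (linN (trp_lin a c)) trp_kapm.
  rewrite (trpC a (kapp (actp c y) x)) !trp_kapp !opE (kappC (actp c y)); zmod.
- by move=> a w; rewrite !opE actp_V; zmod.
- by move=> z w u; rewrite Vp_der !opE.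
- by move=> z u; rewrite kapp_kapp.
Qed.

End Derivations.

Lemma half_der_comb (k : comPzRingType) (P : jkpair k) c tj tj' tm tm' sj sj' sm sm' :
  half_der (P := P) tj tj' tm tm' -> half_der sj sj' sm sm' ->
  half_der (fun a => c *: tj a + sj a) (fun b => c *: tj' b + sj' b)
           (fun x => c *: tm x + sm x) (fun y => c *: tm' y + sm' y).
Proof.
move=> [[l1 l2] t1 t2 t3 t4] [[l3 l4] s1 s2 s3 s4]; split.
- split=> e u v; first by rewrite l1 l3 !scalerDr scalerA mulrC -scalerA; zmod.
  by rewrite l2 l4 !scalerDr scalerA mulrC -scalerA; zmod.
- move=> a b d; rewrite t1 s1 !opE !(linE (trp_lin a d)) !scalerDr; zmod.
- move=> a y; rewrite t2 s2 !opE !scalerDr; zmod.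
- move=> x y z; rewrite t3 s3 !opE !scalerDr; zmod.
- move=> x z; rewrite t4 s4 !opE !scalerDr; zmod.
Qed.

(** The negative of a derivation is a derivation. The signs are placed so that the generators of the
    opposite pair, as produced by [half_der_delta] and [half_der_v], yield those of [P] on the minus
    side. *)
Lemma half_der_opp (k : comPzRingType) (P : jkpair k) tj tj' tm tm' :
  half_der (P := P) tj (fun b => - tj' b) tm (fun y => - tm' y) ->
  half_der (P := P) (fun a => - tj a) tj' (fun x => - tm x) tm'.
Proof.
move=> [[l1 l2] t1 t2 t3 t4]; split.
- by split=> e u v; rewrite ?l1 ?l2 opprD scalerN.
- move=> a b d; rewrite t1 !opE (linN (trp_lin a d)); zmod.
- move=> a y; rewrite t2 !opE; zmod.
- move=> x y z; rewrite t3 !opE; zmod.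
- move=> x z; rewrite t4 !opE; zmod.
Qed.

(** * The Lie algebra ider(P) *)

Section Ider.
Variables (k : comPzRingType) (P : jkpair k).
Implicit Types (S T : ider P) (F : pmod P -> pmod P).

Lemma pmod_eq (p q : pmod P) :
  prJm p = prJm q -> prMm p = prMm q -> prMp p = prMp q -> prJp p = prJp q -> p = q.
Proof.
case: p q => [[[? ?] ?] ?] [[[? ?] ?] ?].
by rewrite /prJm /prMm /prMp /prJp /= => -> -> -> ->.
Qed.

Definition is_der F : Prop := exists tj tj' tm tm',
  [/\ half_der (P := P) tj tj' tm tm', half_der (P := jkpair_opp P) tj' tj tm' tm
    & forall p, F p = mkp (tj' (prJm p)) (tm' (prMm p)) (tm (prMp p)) (tj (prJp p))].

(** Functions of this shape form a submodule containing the generators. Since [ider] is a span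
    inside bare functions, even linearity and preservation of degrees come from here. *)
Lemma is_der_ider T : is_der (ider_fun T).
Proof.
apply: (span_ind (valP T)).
  split.
    have h0 (R : jkpair k) :
        half_der (P := R) (fun=> 0) (fun=> 0) (fun=> 0) (fun=> 0).
      split; first by split=> c u v /=; rewrite scaler0 addr0.
      - by move=> a b c; rewrite !opE (lin0 (trp_lin a c)); zmod.
      - by move=> *; rewrite !opE; zmod.
      - by move=> *; rewrite !opE; zmod.
      - by move=> *; rewrite !opE; zmod.
    by exists (fun=> 0), (fun=> 0), (fun=> 0), (fun=> 0).
  move=> c F G [tj [tj' [tm [tm' [h1 h2 h3]]]]] [sj [sj' [sm [sm' [e1 e2 e3]]]]].
  exists (fun a => c *: tj a + sj a), (fun b => c *: tj' b + sj' b),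
    (fun x => c *: tm x + sm x), (fun y => c *: tm' y + sm' y); split.
  - exact: half_der_comb.
  - exact: half_der_comb.
  - by move=> p; rewrite -[LHS]/(c *: F p + G p) h3 e3.
move=> F [[a [b ->]]|[x [y ->]]].
  exists (trp a b), (fun d => - trm b a d), (fun x => actp a (actm b x)),
    (fun w => - actm b (actp a w)); split; first exact: half_der_delta.
    exact: (half_der_opp (half_der_delta (P := jkpair_opp P) b a)).
  by move=> p; rewrite /der_delta trpE trmE.
exists (fun c => kapp (actp c y) x), (fun d => - kapm (actm d x) y), (Vp x y),
  (fun w => - Vm y x w); split=> //; first exact: half_der_v.
exact: (half_der_opp (half_der_v (P := jkpair_opp P) y x)).
Qed.

Lemma ider_funD S T p : ider_fun (S + T) p = ider_fun S p + ider_fun T p.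
Proof. by []. Qed.
Lemma ider_funZ c T p : ider_fun (c *: T) p = c *: ider_fun T p.
Proof. by []. Qed.

Lemma ider_lin T : is_linear (ider_fun T).
Proof.
have [tj [tj' [tm [tm' [[[l1 l2] _ _ _ _] [[l3 l4] _ _ _ _] E]]]]] := is_der_ider T.
by move=> c p q; rewrite !E; apply: pmod_eq => /=; rewrite ?l1 ?l2 ?l3 ?l4.
Qed.

Lemma half_der_ider T :
  half_der (P := P) (onJp T) (onJm T) (onMp T) (onMm T) /\
  half_der (P := jkpair_opp P) (onJm T) (onJp T) (onMm T) (onMp T).
Proof.
have [tj [tj' [tm [tm' [h1 h2 E]]]]] := is_der_ider T.
have -> : onJp T = tj by apply/funext => a; rewrite /onJp E.
have -> : onJm T = tj' by apply/funext => a; rewrite /onJm E.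
have -> : onMp T = tm by apply/funext => a; rewrite /onMp E.
by have -> : onMm T = tm' by apply/funext => a; rewrite /onMm E.
Qed.

Lemma ider_funE T p :
  ider_fun T p = mkp (onJm T (prJm p)) (onMm T (prMm p)) (onMp T (prMp p)) (onJp T (prJp p)).
Proof.
have [tj [tj' [tm [tm' [h1 h2 E]]]]] := is_der_ider T.
by rewrite /onJp /onJm /onMp /onMm !E.
Qed.

Lemma ider_eq S T : onJp S =1 onJp T -> onJm S =1 onJm T ->
  onMp S =1 onMp T -> onMm S =1 onMm T -> S = T.
Proof.
move=> e1 e2 e3 e4; apply/val_inj/funext => p.
by rewrite -[LHS]/(ider_fun S p) -[RHS]/(ider_fun T p) !ider_funE e1 e2 e3 e4.
Qed.

Lemma prJp_lin : is_linear (@prJp k P). Proof. by []. Qed.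
Lemma prMp_lin : is_linear (@prMp k P). Proof. by []. Qed.
Lemma prJm_lin : is_linear (@prJm k P). Proof. by []. Qed.
Lemma prMm_lin : is_linear (@prMm k P). Proof. by []. Qed.

Definition prE := (linE prJp_lin, linE prMp_lin, linE prJm_lin, linE prMm_lin).

Lemma prJm_mkp b y x a : prJm (mkp (P := P) b y x a) = b. Proof. by []. Qed.
Lemma prMm_mkp b y x a : prMm (mkp (P := P) b y x a) = y. Proof. by []. Qed.
Lemma prMp_mkp b y x a : prMp (mkp (P := P) b y x a) = x. Proof. by []. Qed.
Lemma prJp_mkp b y x a : prJp (mkp (P := P) b y x a) = a. Proof. by []. Qed.

Definition mkpE := (prJm_mkp, prMm_mkp, prMp_mkp, prJp_mkp).

Lemma onJp_bil : is_bilinear (@onJp k P).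
Proof.
split=> [T|u c S T]; first by case: (half_der_ider T) => [[[h _] _ _ _ _] _].
by rewrite /onJp ider_funD ider_funZ prJp_lin.
Qed.
Lemma onMp_bil : is_bilinear (@onMp k P).
Proof.
split=> [T|u c S T]; first by case: (half_der_ider T) => [[[_ h] _ _ _ _] _].
by rewrite /onMp ider_funD ider_funZ prMp_lin.
Qed.
Lemma onJm_bil : is_bilinear (@onJm k P).
Proof.
split=> [T|u c S T]; first by case: (half_der_ider T) => [_ [[h _] _ _ _ _]].
by rewrite /onJm ider_funD ider_funZ prJm_lin.
Qed.
Lemma onMm_bil : is_bilinear (@onMm k P).
Proof.
split=> [T|u c S T]; first by case: (half_der_ider T) => [_ [[_ h] _ _ _ _]].
by rewrite /onMm ider_funD ider_funZ prMm_lin.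
Qed.

Definition bilEl (U V W : lmodType k) (h : U -> V -> W) (H : is_bilinear h) :=
  (bilDl H, bil0l H, bilNl H, bilZl H).
Definition bilEr (U V W : lmodType k) (h : U -> V -> W) (H : is_bilinear h) :=
  (bilDr H, bil0r H, bilNr H, bilZr H).

(* To be used in this order: rewriting by additivity in the second argument
   would see through an inner [onJp (S + T) a]. *)
Definition onlE := (bilEl onJp_bil, bilEl onMp_bil, bilEl onJm_bil, bilEl onMm_bil).
Definition onrE := (bilEr onJp_bil, bilEr onMp_bil, bilEr onJm_bil, bilEr onMm_bil).

Lemma onJp_trp T a b c : onJp T (trp a b c) =
  trp (onJp T a) b c + trp a (onJm T b) c + trp a b (onJp T c).
Proof. by case: (half_der_ider T) => [[_ h _ _ _] _]; apply: h. Qed.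
Lemma onJm_trm T a b c : onJm T (trm a b c) =
  trm (onJm T a) b c + trm a (onJp T b) c + trm a b (onJm T c).
Proof. by case: (half_der_ider T) => [_ [_ h _ _ _]]; apply: h. Qed.
Lemma onMp_actp T a y : onMp T (actp a y) = actp (onJp T a) y + actp a (onMm T y).
Proof. by case: (half_der_ider T) => [[_ _ h _ _] _]; apply: h. Qed.
Lemma onMm_actm T b x : onMm T (actm b x) = actm (onJm T b) x + actm b (onMp T x).
Proof. by case: (half_der_ider T) => [_ [_ _ h _ _]]; apply: h. Qed.
Lemma onMp_Vp T x y z : onMp T (Vp x y z) =
  Vp (onMp T x) y z + Vp x (onMm T y) z + Vp x y (onMp T z).
Proof. by case: (half_der_ider T) => [[_ _ _ h _] _]; apply: h. Qed.
Lemma onMm_Vm T y x w : onMm T (Vm y x w) =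
  Vm (onMm T y) x w + Vm y (onMp T x) w + Vm y x (onMm T w).
Proof. by case: (half_der_ider T) => [_ [_ _ _ h _]]; apply: h. Qed.
Lemma onJp_kapp T x z : onJp T (kapp x z) = kapp (onMp T x) z + kapp x (onMp T z).
Proof. by case: (half_der_ider T) => [[_ _ _ _ h] _]; apply: h. Qed.
Lemma onJm_kapm T y w : onJm T (kapm y w) = kapm (onMm T y) w + kapm y (onMm T w).
Proof. by case: (half_der_ider T) => [_ [_ _ _ _ h]]; apply: h. Qed.

Definition derE := (onJp_trp, onJm_trm, onMp_actp, onMm_actm, onMp_Vp, onMm_Vm,
  onJp_kapp, onJm_kapm).

Lemma onJp_delta a b c : onJp (ider_delta (P := P) a b) c = trp a b c.
Proof. by rewrite -trpE. Qed.
Lemma onJm_delta a b d : onJm (ider_delta (P := P) a b) d = - trm b a d.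
Proof. by rewrite -trmE. Qed.
Lemma onMp_delta a b x : onMp (ider_delta (P := P) a b) x = actp a (actm b x).
Proof. by []. Qed.
Lemma onMm_delta a b y : onMm (ider_delta (P := P) a b) y = - actm b (actp a y).
Proof. by []. Qed.
Lemma onJp_v x y c : onJp (ider_v (P := P) x y) c = kapp (actp c y) x.
Proof. by []. Qed.
Lemma onJm_v x y d : onJm (ider_v (P := P) x y) d = - kapm (actm d x) y.
Proof. by []. Qed.
Lemma onMp_v x y z : onMp (ider_v (P := P) x y) z = Vp x y z.
Proof. by []. Qed.
Lemma onMm_v x y w : onMm (ider_v (P := P) x y) w = - Vm y x w.
Proof. by []. Qed.

Definition genE := (onJp_delta, onJm_delta, onMp_delta, onMm_delta,
  onJp_v, onJm_v, onMp_v, onMm_v).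

(** Span induction concerns functions, while [W] concerns members of the span. It is applied to the
    functions underlying some member satisfying [W], and injectivity of the projection leads
    back. *)
Lemma ider_ind (W : ider P -> Prop) : submodule W ->
  (forall a b, W (ider_delta a b)) -> (forall x y, W (ider_v x y)) -> forall T, W T.
Proof.
move=> [W0 WD] Wd Wv T.
suff [F WF FT] : exists2 F : ider P, W F & ider_fun F = ider_fun T.
  by have -> : T = F by apply/val_inj; rewrite -[LHS]/(ider_fun T) -FT.
apply: (span_ind (W := [set G | exists2 F : ider P, W F & ider_fun F = G]%classic)
  (valP T)).
  split; first by exists 0.
  by move=> c _ _ [F WF <-] [G WG <-]; exists (c *: F + G) => //; apply: WD.
move=> G [[a [b ->]]|[x [y ->]]]; first by exists (ider_delta a b).
by exists (ider_v x y).
Qed.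

(** The commutator as a bare function: its membership in the span has to be known before [ider_br],
    defined with [insubd], can be evaluated. *)
Definition comm F G p := F (G p) - G (F p).

Lemma comm_delta T a b : comm (ider_fun T) (ider_fun (ider_delta a b)) =
  ider_fun (ider_delta (onJp T a) b + ider_delta a (onJm T b)).
Proof.
apply/funext => p; rewrite /comm !ider_funE.
apply: pmod_eq; rewrite !(prE, mkpE) !genE !onlE ?onrE !genE !derE ?opE.
- zmod.
- zmod.
- zmod.
- zmod.
Qed.

Lemma comm_v T x y : comm (ider_fun T) (ider_fun (ider_v x y)) =
  ider_fun (ider_v (onMp T x) y + ider_v x (onMm T y)).
Proof.
apply/funext => p; rewrite /comm !ider_funE.
apply: pmod_eq; rewrite !(prE, mkpE) !genE !onlE ?onrE !genE !derE ?opE.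
- zmod.
- zmod.
- zmod.
- zmod.
Qed.

Lemma comm_ider S T : comm (ider_fun S) (ider_fun T) \in Defs.span (@ider_gen k P).
Proof.
apply: (ider_ind (W := fun T => comm (ider_fun S) (ider_fun T) \in Defs.span (@ider_gen k P))) T.
- split=> [|c F G hF hG].
    rewrite [X in X \in _](_ : _ = 0) ?rpred0 //; apply/funext => p.
    by rewrite /comm -[ider_fun 0 _]/0 -[ider_fun 0 _]/0 (lin0 (ider_lin S)) subr0.
  rewrite [X in X \in _](_ : _ = c *: comm (ider_fun S) (ider_fun F) +
    comm (ider_fun S) (ider_fun G)); first by rewrite rpredD ?rpredZ.
  apply/funext => p; rewrite -[RHS]/(c *: comm _ _ p + comm _ _ p) /comm.
  by rewrite !ider_funD !ider_funZ (ider_lin S) scalerBr opprD addrACA.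
- by move=> a b; rewrite comm_delta; apply: valP.
- by move=> x y; rewrite comm_v; apply: valP.
Qed.

Lemma ider_brE S T p :
  ider_fun (ider_br S T) p = ider_fun S (ider_fun T p) - ider_fun T (ider_fun S p).
Proof.
rewrite /ider_br -[ider_fun (insubd _ _)]/(val _) insubdK //.
exact: comm_ider.
Qed.

End Ider.

(** * The module uider(P) and its map onto ider(P) *)

Section Uider.
Variables (k : comPzRingType) (P : jkpair k).
Implicit Types (S T : ider P) (p q r : uider P).

(** The generators of I(P), imposed on a pair of maps instead of on tensors. The same six conditions
    can then be checked for the generators of [ider], for a derivation acting on diamonds and for
    the images of diamonds under a homomorphism. *)
Definition uider_compat (W : lmodType k)
    (f : Jp P -> Jm P -> W) (g : Mp P -> Mm P -> W) : Prop :=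
  [/\ forall x y, g (Vp x y x) y = g x (Vm y x y),
      forall x u y w, g (Vp x y u) w + g (Vp u w x) y = g u (Vm y x w) + g x (Vm w u y),
      forall a b, f (trp a b a) b = f a (trm b a b),
      forall a c b d, f (trp a b c) d + f (trp c d a) b = f c (trm b a d) + f a (trm b c d)
    & (forall x u b, f (kapp u x) b = g x (actm b u) - g u (actm b x)) /\
      (forall a y w, f a (kapm y w) = g (actp a y) w - g (actp a w) y)].

Lemma uider_lift_spec (W : lmodType k)
    (f : Jp P -> Jm P -> W) (g : Mp P -> Mm P -> W) :
  is_bilinear f -> is_bilinear g -> uider_compat f g ->
  [/\ is_linear (uider_lift f g),
      forall a b, uider_lift f g (diaJ a b) = f a b
    & forall x y, uider_lift f g (diaM x y) = g x y].
Proof.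
move=> bf bg [R1 R2 R3 R4 [R5 R6]]; apply: uider_liftP => // t.
have lf := tlift_is_linear bf; have lg := tlift_is_linear bg.
have D1 (u v : uider_pre P) : (u + v).1 = u.1 + v.1 by [].
have D2 (u v : uider_pre P) : (u + v).2 = u.2 + v.2 by [].
have N1 (u : uider_pre P) : (- u).1 = - u.1 by [].
have N2 (u : uider_pre P) : (- u).2 = - u.2 by [].
case=> [x y|x u y w|a b|a c b d|x u b|a y w];
  rewrite ?trpE ?trmE !(D1, D2, N1, N2) /= !(linE lf) !(linE lg)
    ?(tlift_tensor bf) ?(tlift_tensor bg).
- rewrite R1; zmod.
- zlc (R2 x u y w).
- rewrite R3; zmod.
- zlc (R4 a c b d).
- rewrite R5; zmod.
- rewrite R6; zmod.
Qed.

Lemma diaJ_bil : is_bilinear (@diaJ k P).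
Proof.
have [t1 t2] := tensor_is_bilinear (Jp P) (Jm P).
split=> a c u v; rewrite /diaJ -qpi_is_linear; congr (qpi _ _).
  by rewrite t1 -[RHS]/(_, c *: 0 + 0) scaler0 addr0.
by rewrite (t2 a) -[RHS]/(_, c *: 0 + 0) scaler0 addr0.
Qed.

Lemma diaM_bil : is_bilinear (@diaM k P).
Proof.
have [t1 t2] := tensor_is_bilinear (Mp P) (Mm P).
split=> a c u v; rewrite /diaM -qpi_is_linear; congr (qpi _ _).
  by rewrite t1 -[RHS]/(c *: 0 + 0, _) scaler0 addr0.
by rewrite (t2 a) -[RHS]/(c *: 0 + 0, _) scaler0 addr0.
Qed.

Definition diaE := (bilE diaJ_bil, bilE diaM_bil).

Lemma dia_compat : uider_compat (@diaJ k P) (@diaM k P).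
Proof.
have lin := @qpi_is_linear _ _ (@uider_rel k P).
have rel t : uider_rel t -> qpi (@uider_rel k P) t = 0.
  by move=> rt; rewrite -[RHS](lin0 lin); apply/qpi_eq; rewrite subr0; apply: span_gen.
have qD u v : qpi (@uider_rel k P) (u + v) = qpi (@uider_rel k P) u + qpi (@uider_rel k P) v.
  exact: (linD lin).
have qN u : qpi (@uider_rel k P) (- u) = - qpi (@uider_rel k P) u.
  exact: (linN lin).
have qJ a b : qpi (@uider_rel k P) (tensor a b, 0) = diaJ a b by [].
have qM x y : qpi (@uider_rel k P) (0, tensor x y) = diaM x y by [].
split.
- by move=> x y; have E := rel _ (URel_M x y); rewrite !(qD, qN, qJ, qM) in E; zlc (zopp E).
- by move=> x u y w; have E := rel _ (URel_MM x u y w); rewrite !(qD, qN, qJ, qM) in E; zlc E.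
- move=> a b; have E := rel _ (URel_J a b); rewrite !(qD, qN, qJ, qM) trpE trmE in E.
  zlc (zopp E).
- move=> a c b d; have E := rel _ (URel_JJ a c b d); rewrite !(qD, qN, qJ, qM) trpE trmE in E.
  zlc E.
split.
- by move=> x u b; have E := rel _ (URel_kapp x u b); rewrite !(qD, qN, qJ, qM) in E; zlc E.
- by move=> a y w; have E := rel _ (URel_kapm a y w); rewrite !(qD, qN, qJ, qM) in E; zlc E.
Qed.

Lemma uider_ind (W : uider P -> Prop) : submodule W ->
  (forall a b, W (diaJ a b)) -> (forall x y, W (diaM x y)) -> forall p, W p.
Proof.
move=> [W0 WD] WJ WM p; rewrite -[p]reprK_qpi; case: (repr p) => s t.
have lin := @qpi_is_linear _ _ (@uider_rel k P).
have q0 : qpi (@uider_rel k P) (0, 0) = 0 by exact: (lin0 lin).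
have -> : qpi (@uider_rel k P) (s, t) =
    1 *: qpi (@uider_rel k P) (s, 0) + qpi (@uider_rel k P) (0, t).
  by rewrite -lin scale1r; congr (qpi _ (_, _)); rewrite /= ?addr0 ?add0r.
apply: (WD).
  apply: (tens_ind (W := fun s => W (qpi (@uider_rel k P) (s, 0)))) => //.
  split=> [|c u v hu hv]; first by rewrite q0.
  rewrite (_ : (_, _) = c *: ((u, 0) : uider_pre P) + (v, 0)) ?lin; first exact: (WD).
  by congr (_, _); rewrite /= scaler0 addr0.
apply: (tens_ind (W := fun t => W (qpi (@uider_rel k P) (0, t)))) => //.
split=> [|c u v hu hv]; first by rewrite q0.
rewrite (_ : (_, _) = c *: ((0, u) : uider_pre P) + (0, v)) ?lin; first exact: (WD).
by congr (_, _); rewrite /= scaler0 addr0.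
Qed.

Lemma lin_uider_eq (W : lmodType k) (f g : uider P -> W) :
  is_linear f -> is_linear g -> (forall a b, f (diaJ a b) = g (diaJ a b)) ->
  (forall x y, f (diaM x y) = g (diaM x y)) -> f =1 g.
Proof.
move=> lf lg EJ EM; apply: uider_ind => //; split=> [|c u v Eu Ev].
  by rewrite (lin0 lf) (lin0 lg).
by rewrite lf lg Eu Ev.
Qed.

Lemma onJp_br S T a : onJp (ider_br S T) a = onJp S (onJp T a) - onJp T (onJp S a).
Proof. by rewrite {1}/onJp ider_brE !ider_funE !(prE, mkpE). Qed.
Lemma onJm_br S T a : onJm (ider_br S T) a = onJm S (onJm T a) - onJm T (onJm S a).
Proof. by rewrite {1}/onJm ider_brE !ider_funE !(prE, mkpE). Qed.
Lemma onMp_br S T a : onMp (ider_br S T) a = onMp S (onMp T a) - onMp T (onMp S a).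
Proof. by rewrite {1}/onMp ider_brE !ider_funE !(prE, mkpE). Qed.
Lemma onMm_br S T a : onMm (ider_br S T) a = onMm S (onMm T a) - onMm T (onMm S a).
Proof. by rewrite {1}/onMm ider_brE !ider_funE !(prE, mkpE). Qed.

Definition brE := (onJp_br, onJm_br, onMp_br, onMm_br).

Lemma ider_br_lie : is_lie (@ider_br k P).
Proof.
split.
- split=> S c T R; apply: ider_eq => a; rewrite !brE !onlE !brE ?onrE scalerBr; zmod.
- by move=> T; apply: ider_eq => a; rewrite brE onlE subrr.
- move=> R S T; apply: ider_eq => a; rewrite !onlE !brE !onrE; zmod.
Qed.
Lemma ider_brC S T : ider_br S T = - ider_br T S.
Proof. apply: ider_eq => a; rewrite onlE !brE; zmod. Qed.
Lemma ider_br_delta T a b :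
  ider_br T (ider_delta a b) = ider_delta (onJp T a) b + ider_delta a (onJm T b).
Proof. by apply/val_inj/funext => p; rewrite [LHS]ider_brE -[RHS]/(ider_fun _ p) -comm_delta. Qed.
Lemma ider_br_v T x y :
  ider_br T (ider_v x y) = ider_v (onMp T x) y + ider_v x (onMm T y).
Proof. by apply/val_inj/funext => p; rewrite [LHS]ider_brE -[RHS]/(ider_fun _ p) -comm_v. Qed.

Lemma delta_bil : is_bilinear (@ider_delta k P).
Proof.
split=> a c u v; apply: ider_eq => d; rewrite !onlE !genE ?opE //.
- by rewrite (trp_lin a d).
- by rewrite scalerN opprD.
- by rewrite scalerN opprD.
- by rewrite (trm_lin a d) scalerN opprD.
- by rewrite scalerN opprD.
Qed.

Lemma v_bil : is_bilinear (@ider_v k P).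
Proof.
by split=> x c u v; apply: ider_eq => d; rewrite !onlE !genE ?opE // scalerN opprD.
Qed.

Definition dgenE := (bilE delta_bil, bilE v_bil).

(** The first four relations hold because the commutator is alternating and anticommutative on
    generators. The two involving kappa are not of this kind and are compared on the four components
    of P. *)
Lemma ud_compat : uider_compat (@ider_delta k P) (@ider_v k P).
Proof.
split.
- move=> x y; have [_ h _] := ider_br_lie; have := h (ider_v x y).
  by rewrite ider_br_v !genE !dgenE => E; zlc E.
- move=> x u y w; have := ider_brC (ider_v x y) (ider_v u w).
  by rewrite !ider_br_v !genE !dgenE => E; zlc E.
- move=> a b; have [_ h _] := ider_br_lie; have := h (ider_delta a b).
  by rewrite ider_br_delta !genE !dgenE => E; zlc E.
- move=> a c b d; have := ider_brC (ider_delta a b) (ider_delta c d).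
  by rewrite !ider_br_delta !genE !dgenE (trmC d b) => E; zlc E.
split.
- move=> x u b; apply: ider_eq => d; rewrite !onlE !genE.
  + by rewrite trp_kapp (kappC u); zmod.
  + by rewrite trm_kapp (kapmC (actm b x)) ?opE; zmod.
  + by rewrite kapp_actact.
  + by rewrite act_kapp; zmod.
- move=> a y w; apply: ider_eq => d; rewrite !onlE !genE.
  + by rewrite trp_kapm (kappC (actp a w)); zmod.
  + by rewrite trm_kapm (kapmC y) ?opE; zmod.
  + by rewrite act_kapm.
  + by rewrite kapm_actact; zmod.
Qed.

Lemma ud_lin : is_linear (@ud k P).
Proof. by have [] := uider_lift_spec delta_bil v_bil ud_compat. Qed.
Lemma ud_diaJ a b : ud (diaJ (P := P) a b) = ider_delta a b.
Proof. by have [_ h _] := uider_lift_spec delta_bil v_bil ud_compat; apply: h. Qed.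
Lemma ud_diaM x y : ud (diaM (P := P) x y) = ider_v x y.
Proof. by have [_ _ h] := uider_lift_spec delta_bil v_bil ud_compat; apply: h. Qed.

End Uider.

(** * The action of ider(P) on uider(P) and the bracket *)

Section UiderLie.
Variables (k : comPzRingType) (P : jkpair k).
Implicit Types (S T : ider P) (p q r : uider P).

Lemma act_compat T :
  uider_compat (fun a b => diaJ (onJp T a) b + diaJ a (onJm T b))
               (fun x y => diaM (onMp T x) y + diaM x (onMm T y)).
Proof.
have [R1 R2 R3 R4 [R5 R6]] := dia_compat P.
split.
- move=> x y; rewrite !derE !diaE.
  (* A derivation applied to a relation with repeated arguments gives its polarization with [T] on
     one copy of [x], plus the one with [T] on one copy of [y]. *)
  zlc (zadd (R2 x (onMp T x) y y) (R2 x x y (onMm T y))).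
- move=> x u y w; rewrite !derE !diaE.
  zlc (zadd (zadd (R2 (onMp T x) u y w) (R2 x (onMp T u) y w))
            (zadd (R2 x u (onMm T y) w) (R2 x u y (onMm T w)))).
- move=> a b; rewrite !derE !diaE.
  have E := zadd (R4 a (onJp T a) b b) (R4 a a b (onJm T b)).
  rewrite (trmC b (onJm T b)) in E; rewrite (trmC b (onJm T b)); zlc E.
- move=> a c b d; rewrite !derE !diaE.
  zlc (zadd (zadd (R4 (onJp T a) c b d) (R4 a (onJp T c) b d))
            (zadd (R4 a c (onJm T b) d) (R4 a c b (onJm T d)))).
split.
- move=> x u b; rewrite !derE !diaE.
  zlc (zadd (R5 (onMp T x) u b) (zadd (R5 x (onMp T u) b) (R5 x u (onJm T b)))).
- move=> a y w; rewrite !derE !diaE.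
  zlc (zadd (R6 (onJp T a) y w) (zadd (R6 a (onMm T y) w) (R6 a y (onMm T w)))).
Qed.

Lemma act_spec T :
  [/\ is_linear (uider_act T),
      forall a b, uider_act T (diaJ a b) = diaJ (onJp T a) b + diaJ a (onJm T b)
    & forall x y, uider_act T (diaM x y) = diaM (onMp T x) y + diaM x (onMm T y)].
Proof.
apply: uider_lift_spec; last exact: act_compat.
- split=> a c u v; rewrite !onrE !diaE !scalerDr; zmod.
- split=> a c u v; rewrite !onrE !diaE !scalerDr; zmod.
Qed.

(* Locked, to keep unification from unfolding it. *)
Definition act : ider P -> uider P -> uider P := locked (@uider_act k P).

Lemma actE : @uider_act k P = act. Proof. exact: lock. Qed.

Lemma act_lin T : is_linear (act T).
Proof. by rewrite -actE; case: (act_spec T). Qed.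
Lemma act_diaJ T a b : act T (diaJ a b) = diaJ (onJp T a) b + diaJ a (onJm T b).
Proof. by rewrite -actE; case: (act_spec T). Qed.
Lemma act_diaM T x y : act T (diaM x y) = diaM (onMp T x) y + diaM x (onMm T y).
Proof. by rewrite -actE; case: (act_spec T). Qed.

Lemma act_bil : is_bilinear act.
Proof.
split=> [T|q c S T]; first exact: act_lin.
move: q; apply: lin_uider_eq => [|d u v|a b|x y].
- exact: act_lin.
- rewrite (act_lin S d u v) (act_lin T d u v) 2!scalerDr scalerA mulrC -scalerA; zmod.
- rewrite !act_diaJ !onlE !diaE scalerDr; zmod.
- rewrite !act_diaM !onlE !diaE scalerDr; zmod.
Qed.

Lemma act_br S T q :
  act (ider_br S T) q = act S (act T q) - act T (act S q).
Proof.
move: q; apply: lin_uider_eq => [|d u v|a b|x y].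
- exact: act_lin.
- rewrite (act_lin T d u v) (act_lin S d u v) (act_lin S d (act T u)).
  rewrite (act_lin T d (act S u)) scalerBr; zmod.
- rewrite !act_diaJ !(linD (act_lin _)) !act_diaJ !brE !diaE; zmod.
- rewrite !act_diaM !(linD (act_lin _)) !act_diaM !brE !diaE; zmod.
Qed.

Lemma ud_act T q : ud (act T q) = ider_br T (ud q).
Proof.
have [[b1 _] _ _] := ider_br_lie P.
move: q; apply: lin_uider_eq => [d u v|d u v|a b|x y].
- by rewrite (act_lin T d u v) (ud_lin d).
- by rewrite (ud_lin d u v) (b1 T d).
- by rewrite act_diaJ (linD (@ud_lin k P)) !ud_diaJ ider_br_delta.
- by rewrite act_diaM (linD (@ud_lin k P)) !ud_diaM ider_br_v.
Qed.

Lemma uider_br_bil : is_bilinear (@uider_br k P).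
Proof.
split=> p c u v; rewrite /uider_br actE; first exact: act_lin.
by rewrite (ud_lin c u v) (act_bil.2 p c).
Qed.

(** Anticommutativity between the two kinds of generators. It is not itself a relation of I(P): the
    two kappa relations give it, their common term (a o y) <> (b o x) cancelling. *)
Lemma act_delta_v a b x y :
  act (ider_delta a b) (diaM x y) + act (ider_v x y) (diaJ a b) = 0 :> uider P.
Proof.
have [_ _ _ _ [R5 R6]] := dia_compat P.
rewrite act_diaM act_diaJ !genE !diaE R5 R6; zmod.
Qed.

Lemma uider_brC p q : uider_br p q = - uider_br q p.
Proof.
have [R1 R2 R3 R4 [R5 R6]] := dia_compat P.
have lr q' : is_linear (fun p' => - uider_br p' q').
  by move=> c u v; rewrite (uider_br_bil.2 q') opprD scalerN.
move: p; apply: lin_uider_eq => [||a b|x y].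
- exact: uider_br_bil.2.
- by move=> c u v; rewrite (uider_br_bil.1 q) opprD scalerN.
- move: q; apply: lin_uider_eq => [||c d|z w].
  + exact: uider_br_bil.1.
  + exact: lr.
  + rewrite /uider_br ?actE !ud_diaJ !act_diaJ !genE !diaE (trmC d b).
    zlc (R4 a c b d).
  + rewrite /uider_br ?actE ud_diaJ ud_diaM; zlc (act_delta_v a b z w).
- move: q; apply: lin_uider_eq => [||c d|z w].
  + exact: uider_br_bil.1.
  + exact: lr.
  + rewrite /uider_br ?actE ud_diaJ ud_diaM; zlc (act_delta_v c d x y).
  + rewrite /uider_br ?actE !ud_diaM !act_diaM !genE !diaE.
    zlc (R2 x z y w).
Qed.

(** The elements with zero square form a submodule because the bracket is already known to be
    anticommutative, so generators suffice; there the quadratic relations apply. *)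
Lemma uider_brxx p : uider_br p p = 0.
Proof.
have [R1 _ R3 _ _] := dia_compat P.
move: p; apply: uider_ind => [|a b|x y].
- split=> [|c u v Eu Ev]; first by rewrite (bil0l uider_br_bil).
  rewrite (uider_br_bil.2 _ c u v) (uider_br_bil.1 u c u v) (uider_br_bil.1 v c u v).
  by rewrite Eu Ev (uider_brC v u) scalerN scaler0 add0r addr0 subrr.
- rewrite /uider_br ?actE ud_diaJ act_diaJ !genE !diaE R3; zmod.
- rewrite /uider_br ?actE ud_diaM act_diaM !genE !diaE R1; zmod.
Qed.

(** As [ud] intertwines the action with the commutator, the Jacobi identity says that [uider] is a
    module over [ider], which is [act_br]. *)
Lemma uider_br_lie : is_lie (@uider_br k P).
Proof.
split; [exact: uider_br_bil|exact: uider_brxx|move=> p q r].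
have -> : uider_br r (uider_br p q) = - uider_br (uider_br p q) r by exact: uider_brC.
have -> : uider_br q (uider_br r p) = - uider_br q (uider_br p r).
  by rewrite (uider_brC r p) (bilNr uider_br_bil).
rewrite {6}/uider_br {5}/uider_br !actE.
rewrite [ud (act _ _)]ud_act act_br /uider_br ?actE; zmod.
Qed.

End UiderLie.

(** * The Lie algebra on the sum of P and D0 *)

(* Linear combinations with the module structure kept folded, as the elaborated
   instances of [+] and [*:] on [lhat] are not syntactically unique. *)
Definition comb (k : pzRingType) (V : lmodType k) c (u v : V) := c *: u + v.
Definition sum3 (k : pzRingType) (V : lmodType k) (u v w : V) := u + v + w.

Section LHatElements.
Variables (k : comPzRingType) (P : jkpair k) (D0 : lmodType k).

Definition lmk (b : Jm P) (y : Mm P) (x : Mp P) (a : Jp P) (X : D0) : lhat P D0 :=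
  (mkp b y x a, X).

Lemma lhat_case (W : lhat P D0 -> Prop) :
  (forall b y x a X, W (lmk b y x a X)) -> forall z, W z.
Proof. by move=> h [[[[b y] x] a] X]; apply: h. Qed.

Lemma comb_lmk c b y x a X b' y' x' a' X' :
  comb c (lmk b y x a X) (lmk b' y' x' a' X') =
  lmk (c *: b + b') (c *: y + y') (c *: x + x') (c *: a + a') (c *: X + X').
Proof. by []. Qed.

Lemma sum3_lmk b y x a X b' y' x' a' X' b2 y2 x2 a2 X2 :
  sum3 (lmk b y x a X) (lmk b' y' x' a' X') (lmk b2 y2 x2 a2 X2) =
  lmk (b + b' + b2) (y + y' + y2) (x + x' + x2) (a + a' + a2) (X + X' + X2).
Proof. by []. Qed.

Lemma lmk_eq b y x a X b' y' x' a' X' :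
  b = b' -> y = y' -> x = x' -> a = a' -> X = X' ->
  lmk b y x a X = lmk b' y' x' a' X'.
Proof. by move=> -> -> -> -> ->. Qed.

End LHatElements.

Section LHatLie.
Variables (k : comPzRingType) (P : jkpair k) (D0 : lmodType k).
Variables (br0 : D0 -> D0 -> D0) (f : uider P -> D0) (g : D0 -> ider P).
Hypotheses (lie0 : is_lie br0) (linf : is_linear f) (ling : is_linear g).
Hypothesis homg : forall X Y, g (br0 X Y) = ider_br (g X) (g Y).
Hypothesis gf : forall p, g (f p) = ud p.
Hypothesis br0f : forall X p, br0 X (f p) = f (uider_act (g X) p).

Let bil0 : is_bilinear br0. Proof. by case: lie0. Qed.

Lemma lhat_brE b y x a X b' y' x' a' X' :
  lhat_br br0 f g (lmk b y x a X) (lmk b' y' x' a' X') =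
  lmk (kapm y y' + (onJm (g X) b' - onJm (g X') b))
      (actm b x' - actm b' x + (onMm (g X) y' - onMm (g X') y))
      (actp a y' - actp a' y + (onMp (g X) x' - onMp (g X') x))
      (kapp x x' + (onJp (g X) a' - onJp (g X') a))
      (f (diaJ a b') + f (diaM x y') - (f (diaJ a' b) + f (diaM x' y)) + br0 X X').
Proof.
rewrite /lhat_br /lmk !ider_funE !mkpE; congr (_, _); last first.
  rewrite -[LHS]/(0 + (f (diaJ a b') + f (diaM x y')) -
    (f (diaJ a' b) + f (diaM x' y)) + br0 X X'); zmod.
apply: pmod_eq; rewrite !(prE, mkpE); zmod.
Qed.

Let gfJ a b : g (f (diaJ a b)) = ider_delta a b.
Proof. by rewrite gf ud_diaJ. Qed.
Let gfM x y : g (f (diaM x y)) = ider_v x y.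
Proof. by rewrite gf ud_diaM. Qed.
Let br0J X a b : br0 X (f (diaJ a b)) = f (diaJ (onJp (g X) a) b) + f (diaJ a (onJm (g X) b)).
Proof. by rewrite br0f actE act_diaJ (linD linf). Qed.
Let br0M X x y : br0 X (f (diaM x y)) = f (diaM (onMp (g X) x) y) + f (diaM x (onMm (g X) y)).
Proof. by rewrite br0f actE act_diaM (linD linf). Qed.

Lemma lhat_br_bil : is_bilinear (lhat_br br0 f g).
Proof.
split=> z c u v; move: z u v; apply: lhat_case => b1 y1 x1 a1 X1;
  apply: lhat_case => b2 y2 x2 a2 X2; apply: lhat_case => b3 y3 x3 a3 X3.
- rewrite -!/(comb c _ _) comb_lmk !lhat_brE comb_lmk; apply: lmk_eq;
    rewrite ?(linE ling) ?onlE ?onrE ?opE ?diaE ?(linE linf) ?(bilE bil0);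
    rewrite ?(scalerDr, scalerN); zmod.
- rewrite -!/(comb c _ _) comb_lmk !lhat_brE comb_lmk; apply: lmk_eq;
    rewrite ?(linE ling) ?onlE ?onrE ?opE ?diaE ?(linE linf) ?(bilE bil0);
    rewrite ?(scalerDr, scalerN); zmod.
Qed.

Lemma lhat_brzz z : lhat_br br0 f g z z = 0.
Proof.
have [_ alt _] := lie0.
move: z; apply: lhat_case => b y x a X.
rewrite lhat_brE -[RHS]/(lmk 0 0 0 0 0); apply: lmk_eq.
- rewrite kapmxx; zmod.
- zmod.
- zmod.
- rewrite kappxx; zmod.
- rewrite alt; zmod.
Qed.

Lemma lhat_jacobi z1 z2 z3 :
  sum3 (lhat_br br0 f g z1 (lhat_br br0 f g z2 z3))
       (lhat_br br0 f g z2 (lhat_br br0 f g z3 z1))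
       (lhat_br br0 f g z3 (lhat_br br0 f g z1 z2)) = 0.
Proof.
have [_ _ jac0] := lie0.
have [_ _ _ _ [R5 R6]] := dia_compat P.
move: z1 z2 z3; apply: lhat_case => b1 y1 x1 a1 X1; apply: lhat_case => b2 y2 x2 a2 X2.
apply: lhat_case => b3 y3 x3 a3 X3.
rewrite !lhat_brE sum3_lmk -[RHS]/(lmk 0 0 0 0 0); apply: lmk_eq.
- rewrite ?(linE ling) ?homg ?gfJ ?gfM ?onlE ?genE ?brE ?onrE ?derE ?opE.
  (* Atoms are compared syntactically, so each product symmetric or alternating in two arguments is
     put into one order; explicit instances are used since the general rules would apply again to
     their own results. *)
  rewrite (trmC b1 b2) (trmC b1 b3) (trmC b2 b3).
  rewrite (kapmC y1 (actm b2 x3)) (kapmC y1 (actm b3 x2)) (kapmC y2 (actm b1 x3)).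
  rewrite (kapmC y2 (actm b3 x1)) (kapmC y3 (actm b1 x2)) (kapmC y3 (actm b2 x1)).
  rewrite (kapmC y1 (onMm (g X2) y3)) (kapmC y2 (onMm (g X3) y1)).
  rewrite (kapmC y3 (onMm (g X1) y2)).
  zmod.
- rewrite ?(linE ling) ?homg ?gfJ ?gfM ?onlE ?genE ?brE ?onrE ?derE ?opE.
  rewrite ?kapm_act; zmod.
- rewrite ?(linE ling) ?homg ?gfJ ?gfM ?onlE ?genE ?brE ?onrE ?derE ?opE.
  rewrite ?kapp_act; zmod.
- rewrite ?(linE ling) ?homg ?gfJ ?gfM ?onlE ?genE ?brE ?onrE ?derE ?opE.
  rewrite (trpC a1 a2) (trpC a1 a3) (trpC a2 a3).
  rewrite (kappC x1 (actp a2 y3)) (kappC x1 (actp a3 y2)) (kappC x2 (actp a1 y3)).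
  rewrite (kappC x2 (actp a3 y1)) (kappC x3 (actp a1 y2)) (kappC x3 (actp a2 y1)).
  rewrite (kappC x1 (onMp (g X2) x3)) (kappC x2 (onMp (g X3) x1)).
  rewrite (kappC x3 (onMp (g X1) x2)).
  zmod.
(* By the two kappa relations all diamonds cancel, and only the Jacobi identity of [D0] is left. *)
- rewrite ?(bilE bil0) ?br0J ?br0M ?diaE ?R5 ?R6 ?(linE linf).
  zlc (jac0 X1 X2 X3).
Qed.

Lemma lhat_br_lie : is_lie (lhat_br br0 f g).
Proof.
split; [exact: lhat_br_bil|exact: lhat_brzz|exact: lhat_jacobi].
Qed.

End LHatLie.

(** * The 5-grading *)

Section Grading.
Variables (k : comPzRingType) (P : jkpair k) (D0 : lmodType k).
Implicit Types i j : int.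

(** Trades the distinction of six cases for five independent vanishing conditions, so that later
    statements about degrees can be checked one component at a time. *)
Lemma lhat_degP i b y x a X : @lhat_deg k P D0 i (lmk b y x a X) <->
  [/\ i != -2 -> b = 0, i != -1 -> y = 0, i != 1 -> x = 0, i != 2 -> a = 0
    & i != 0 -> X = 0].
Proof.
rewrite /lhat_deg.
have [->|n2] := eqVneq i 2.
  split=> [[a' [-> -> -> _ ->]] //|[-> // -> // -> // _ -> //]].
  by exists a.
have [->|n1] := eqVneq i 1.
  split=> [[a' [-> -> _ -> ->]] //|[-> // -> // _ -> // -> //]].
  by exists x.
have [->|n0] := eqVneq i 0.
  split=> [[a' [-> -> -> -> _]] //|[-> // -> // -> // -> // _]].
  by exists X.
have [->|m1] := eqVneq i (-1).
  split=> [[a' [-> _ -> -> ->]] //|[-> // _ -> // -> // -> //]].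
  by exists y.
have [_|m2] := eqVneq i (-2).
  split=> [[a' [_ -> -> -> ->]] //|[_ -> // -> // -> // -> //]].
  by exists b.
rewrite -[_ = 0]/(lmk b y x a X = lmk 0 0 0 0 0).
by split=> [[-> -> -> -> ->] //|[-> // -> // -> // -> // -> //]].
Qed.

Definition lhat_pc i (z : lhat P D0) : lhat P D0 :=
  lmk (if i == -2 then prJm z.1 else 0) (if i == -1 then prMm z.1 else 0)
      (if i == 1 then prMp z.1 else 0) (if i == 2 then prJp z.1 else 0)
      (if i == 0 then z.2 else 0).

Lemma lhat_pc_deg i z : lhat_deg i (lhat_pc i z).
Proof. by apply/lhat_degP; split=> /negPf ->. Qed.

Lemma lhat_pcE i j z : lhat_deg j z -> lhat_pc i z = if i == j then z else 0.
Proof.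
move: z; apply: lhat_case => b y x a X /lhat_degP [hb hy hx ha hX].
have -> : (if i == j then lmk b y x a X else 0) = lmk (if i == j then b else 0)
  (if i == j then y else 0) (if i == j then x else 0) (if i == j then a else 0)
  (if i == j then X else 0) by case: ifP.
have E (V : zmodType) (v : V) n : (j != n -> v = 0) ->
    (if i == n then v else 0) = if i == j then v else 0.
  have [->|nij] := eqVneq i j; first by case: eqVneq => // _ ->.
  have [<-|//] := eqVneq i n => h; apply: h; by rewrite eq_sym.
by rewrite /lhat_pc /= -!(E _ _ _ hb, E _ _ _ hy, E _ _ _ hx, E _ _ _ ha, E _ _ _ hX).
Qed.

Lemma lhat_pc_sum i (s : seq int) (c : int -> lhat P D0) :
  lhat_pc i (\sum_(j <- s) c j) = \sum_(j <- s) lhat_pc i (c j).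
Proof.
apply: (big_morph (lhat_pc i)) => [u v|].
  rewrite /lhat_pc -[RHS]/(lmk _ _ _ _ _) /=.
  by apply: lmk_eq; case: ifP => // _; rewrite ?addr0.
by rewrite /lhat_pc; apply: lmk_eq; case: ifP.
Qed.

Lemma lhat_deg_submod i : submodule (@lhat_deg k P D0 i).
Proof.
split; first by rewrite -[0]/(lmk 0 0 0 0 0); apply/lhat_degP.
move=> c; apply: lhat_case => b y x a X; apply: lhat_case => b' y' x' a' X'.
move=> /lhat_degP [h1 h2 h3 h4 h5] /lhat_degP [e1 e2 e3 e4 e5].
rewrite -/(comb c _ _) comb_lmk; apply/lhat_degP.
split=> ni; rewrite ?(h1, h2, h3, h4, h5) // ?(e1, e2, e3, e4, e5) //;
  by rewrite scaler0 addr0.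
Qed.

Lemma lhat_deg_br br0 f g i j z z' :
  is_bilinear br0 -> is_linear f -> is_linear g ->
  @lhat_deg k P D0 i z -> lhat_deg j z' -> lhat_deg (i + j) (lhat_br br0 f g z z').
Proof.
move=> bil0 linf ling.
move: z z'; apply: lhat_case => b y x a X; apply: lhat_case => b' y' x' a' X'.
move=> /lhat_degP [h1 h2 h3 h4 h5] /lhat_degP [e1 e2 e3 e4 e5].
(* A bilinear term in components of degrees [m] and [n] can be nonzero only if the total degree is
   [m + n]; [E'] is the version for terms whose first argument comes from the second factor. An
   element of [D0] acting through [g] counts as degree 0. *)
have E (U V W : lmodType k) (h : U -> V -> W) u v (m n : int) :
    (i != m -> u = 0) -> (j != n -> v = 0) -> is_bilinear h ->
    i + j != m + n -> h u v = 0.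
  move=> hu hv bh; have [->|im] := eqVneq i m; last by rewrite hu // (bil0l bh).
  by have [->|jn] := eqVneq j n; [rewrite eqxx|rewrite hv // (bil0r bh)].
have E' (U V W : lmodType k) (h : U -> V -> W) u v (m n : int) :
    (i != n -> v = 0) -> (j != m -> u = 0) -> is_bilinear h ->
    i + j != m + n -> h u v = 0.
  move=> hv hu bh; rewrite addrC.
  have [->|jm] := eqVneq j m; last by rewrite hu // (bil0l bh).
  by have [->|iin] := eqVneq i n; [rewrite eqxx|rewrite hv // (bil0r bh)].
have h5' : i != 0 -> g X = 0 by move=> /h5 ->; rewrite (lin0 ling).
have e5' : j != 0 -> g X' = 0 by move=> /e5 ->; rewrite (lin0 ling).
rewrite lhat_brE //; apply/lhat_degP; split=> ij.
- rewrite (E _ _ _ _ _ _ _ _ h2 e2 (@kapm_bil k P)) //.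
  rewrite (E _ _ _ _ _ _ _ _ h5' e1 (@onJm_bil k P)) //.
  by rewrite (E' _ _ _ _ _ _ _ _ h1 e5' (@onJm_bil k P)) // subrr addr0.
- rewrite (E _ _ _ _ _ _ _ _ h1 e3 (@actm_bil k P)) //.
  rewrite (E' _ _ _ _ _ _ _ _ h3 e1 (@actm_bil k P)) //.
  rewrite (E _ _ _ _ _ _ _ _ h5' e2 (@onMm_bil k P)) //.
  by rewrite (E' _ _ _ _ _ _ _ _ h2 e5' (@onMm_bil k P)) // subrr addr0.
- rewrite (E _ _ _ _ _ _ _ _ h4 e2 (@actp_bil k P)) //.
  rewrite (E' _ _ _ _ _ _ _ _ h2 e4 (@actp_bil k P)) //.
  rewrite (E _ _ _ _ _ _ _ _ h5' e3 (@onMp_bil k P)) //.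
  by rewrite (E' _ _ _ _ _ _ _ _ h3 e5' (@onMp_bil k P)) // subrr addr0.
- rewrite (E _ _ _ _ _ _ _ _ h3 e3 (@kapp_bil k P)) //.
  rewrite (E _ _ _ _ _ _ _ _ h5' e4 (@onJp_bil k P)) //.
  by rewrite (E' _ _ _ _ _ _ _ _ h4 e5' (@onJp_bil k P)) // subrr addr0.
- rewrite (E _ _ _ _ _ _ _ _ h4 e1 (@diaJ_bil k P)) //.
  rewrite (E _ _ _ _ _ _ _ _ h3 e2 (@diaM_bil k P)) //.
  rewrite (E' _ _ _ _ _ _ _ _ h1 e4 (@diaJ_bil k P)) //.
  rewrite (E' _ _ _ _ _ _ _ _ h2 e3 (@diaM_bil k P)) //.
  rewrite (E _ _ _ _ _ _ _ _ h5 e5 bil0) //.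
  rewrite (lin0 linf); zmod.
Qed.

Lemma lhat_graded br0 f g : is_bilinear br0 -> is_linear f -> is_linear g ->
  is_graded (lhat_br br0 f g) (@lhat_deg k P D0).
Proof.
move=> bil0 linf ling; split.
- exact: lhat_deg_submod.
- move=> z; exists [:: -2; -1; 0; 1; 2], (fun i => lhat_pc i z); split.
    by move=> i; apply: lhat_pc_deg.
  move: z; apply: lhat_case => b y x a X.
  rewrite !big_cons big_nil /lhat_pc /=.
  by apply: lmk_eq; rewrite /= ?addr0 ?add0r.
- move=> s c us degc sum0 i si.
  (* The projection to degree [i] annihilates all other summands, so it isolates [c i] in the
     vanishing sum. *)
  have := lhat_pc_sum i s c; rewrite sum0.
  rewrite (bigD1_seq i) //= big1; last first.
    by move=> j ji; rewrite (lhat_pcE i (degc j)) eq_sym (negPf ji).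
  rewrite (lhat_pcE i (degc i)) eqxx addr0 => <-.
  by rewrite /lhat_pc; apply: lmk_eq; case: ifP.
- by move=> i j z z'; apply: lhat_deg_br.
Qed.

Lemma lhat_deg_bound i : (2 < `|i|)%N -> (@lhat_deg k P D0 i `<=` [set 0])%classic.
Proof.
move=> hi; apply: lhat_case => b y x a X /lhat_degP [h1 h2 h3 h4 h5].
have ni n : (`|n| <= 2)%N -> i != n by apply: contraTneq => <-; rewrite -ltnNge.
by rewrite h1 ?h2 ?h3 ?h4 ?h5 ?ni.
Qed.

End Grading.

(** * Homomorphisms *)

Section LHatMap.
Variables (k : comPzRingType) (P Q : jkpair k) (h : jkhom P Q).
Variables (D1 D2 : lmodType k).
Variables (br1 : D1 -> D1 -> D1) (f1 : uider P -> D1) (g1 : D1 -> ider P).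
Variables (br2 : D2 -> D2 -> D2) (f2 : uider Q -> D2) (g2 : D2 -> ider Q).
Hypotheses (linf1 : is_linear f1) (linf2 : is_linear f2).

Section Hom.
Variable phi : D1 -> D2.
Hypotheses (linphi : is_linear phi).
Hypothesis phi_br : forall X Y, phi (br1 X Y) = br2 (phi X) (phi Y).
Hypothesis phiJ : forall a b, phi (f1 (diaJ a b)) = f2 (diaJ (hJp h a) (hJm h b)).
Hypothesis phiM : forall x y, phi (f1 (diaM x y)) = f2 (diaM (hMp h x) (hMm h y)).
Hypothesis phi_act : forall X p,
  pmod_map h (ider_fun (g1 X) p) = ider_fun (g2 (phi X)) (pmod_map h p).

(** One map for both uses: with [jkid P] it extends [f] or [g] by the identity of P, and with
    [phi := uider_map h] it is convertible to [ULE_map h]. *)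
Definition lhat_map (z : lhat P D1) : lhat Q D2 := (pmod_map h z.1, phi z.2).

Lemma lhat_map_lmk b y x a X : lhat_map (lmk b y x a X) =
  lmk (hJm h b) (hMm h y) (hMp h x) (hJp h a) (phi X).
Proof. by []. Qed.

Let linJm : is_linear (hJm h). Proof. by move=> c u v; rewrite linearP. Qed.
Let linMm : is_linear (hMm h). Proof. by move=> c u v; rewrite linearP. Qed.
Let linMp : is_linear (hMp h). Proof. by move=> c u v; rewrite linearP. Qed.
Let linJp : is_linear (hJp h). Proof. by move=> c u v; rewrite linearP. Qed.

Let onE p X :
  [/\ hJm h (onJm (g1 X) (prJm p)) = onJm (g2 (phi X)) (hJm h (prJm p)),
      hMm h (onMm (g1 X) (prMm p)) = onMm (g2 (phi X)) (hMm h (prMm p)),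
      hMp h (onMp (g1 X) (prMp p)) = onMp (g2 (phi X)) (hMp h (prMp p))
    & hJp h (onJp (g1 X) (prJp p)) = onJp (g2 (phi X)) (hJp h (prJp p))].
Proof. by have := phi_act X p; rewrite !ider_funE => -[]. Qed.

Lemma lhat_map_linear : is_linear lhat_map.
Proof.
move=> c; apply: lhat_case => b y x a X; apply: lhat_case => b' y' x' a' X'.
rewrite -!/(comb c _ _) comb_lmk !lhat_map_lmk comb_lmk.
by rewrite linJm linMm linMp linJp linphi.
Qed.

Lemma lhat_map_hom : lie_hom (lhat_br br1 f1 g1) (lhat_br br2 f2 g2) lhat_map.
Proof.
split; first exact: lhat_map_linear.
apply: lhat_case => b y x a X; apply: lhat_case => b' y' x' a' X'.
rewrite lhat_brE // !lhat_map_lmk lhat_brE //.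
have [e1 e2 e3 e4] := onE (mkp b' y' x' a') X.
have [e5 e6 e7 e8] := onE (mkp b y x a) X'.
rewrite !mkpE in e1 e2 e3 e4 e5 e6 e7 e8.
apply: lmk_eq.
- by rewrite !(linE linJm) hom_kapm e1 e5.
- by rewrite !(linE linMm) !hom_actm e2 e6.
- by rewrite !(linE linMp) !hom_actp e3 e7.
- by rewrite !(linE linJp) hom_kapp e4 e8.
- by rewrite !(linE linphi) !phiJ !phiM phi_br.
Qed.

Lemma lhat_map_deg i z : lhat_deg i z -> lhat_deg i (lhat_map z).
Proof.
move: z; apply: lhat_case => b y x a X /lhat_degP [h1 h2 h3 h4 h5].
rewrite lhat_map_lmk; apply/lhat_degP; split=> ni.
- by rewrite h1 // (lin0 linJm).
- by rewrite h2 // (lin0 linMm).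
- by rewrite h3 // (lin0 linMp).
- by rewrite h4 // (lin0 linJp).
- by rewrite h5 // (lin0 linphi).
Qed.

End Hom.

(* As f1 is onto, P generates the source. *)
Lemma lhat_hom_eq F F' :
  is_bilinear br1 -> is_linear g1 -> (forall X, exists p, f1 p = X) ->
  lie_hom (lhat_br br1 f1 g1) (lhat_br br2 f2 g2) F ->
  lie_hom (lhat_br br1 f1 g1) (lhat_br br2 f2 g2) F' ->
  (forall p, F (p, 0) = F' (p, 0)) -> F = F'.
Proof.
move=> bil1 ling1 surj [lF hF] [lF' hF'] FF'.
have bJ a b : lmk 0 0 0 0 (f1 (diaJ a b)) =
    lhat_br br1 f1 g1 (lmk 0 0 0 a 0) (lmk b 0 0 0 0).
  rewrite lhat_brE // (lin0 ling1); apply: lmk_eq;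
    rewrite ?opE ?onlE ?onrE ?diaE ?(bilE bil1) ?(lin0 linf1); zmod.
have bM x y : lmk 0 0 0 0 (f1 (diaM x y)) =
    lhat_br br1 f1 g1 (lmk 0 0 x 0 0) (lmk 0 y 0 0 0).
  rewrite lhat_brE // (lin0 ling1); apply: lmk_eq;
    rewrite ?opE ?onlE ?onrE ?diaE ?(bilE bil1) ?(lin0 linf1); zmod.
have linl (G : lhat P D1 -> lhat Q D2) : is_linear G ->
    is_linear (fun p => G (lmk 0 0 0 0 (f1 p))).
  move=> lG c p q; rewrite -lG -/(comb c (lmk 0 0 0 0 (f1 p)) _) comb_lmk.
  by congr (G (lmk _ _ _ _ _)); rewrite ?scaler0 ?addr0 // linf1.
have Ef p : F (lmk 0 0 0 0 (f1 p)) = F' (lmk 0 0 0 0 (f1 p)).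
  move: p; apply: lin_uider_eq; [exact: linl|exact: linl|move=> a b|move=> x y].
    by rewrite bJ hF hF' !FF'.
  by rewrite bM hF hF' !FF'.
apply/funext; apply: lhat_case => b y x a X; have [p <-] := surj X.
have -> : lmk b y x a (f1 p) = comb 1 (mkp b y x a, 0) (lmk 0 0 0 0 (f1 p)).
  rewrite -[(mkp b y x a, 0)]/(lmk b y x a 0) comb_lmk.
  by apply: lmk_eq; rewrite scale1r ?addr0 ?add0r.
by rewrite /comb lF lF' Ef FF'.
Qed.

End LHatMap.

(** * Functoriality of uider *)

Section UiderMap.
Variables (k : comPzRingType) (P Q : jkpair k) (h : jkhom P Q).

Let linJm : is_linear (hJm h). Proof. by move=> c u v; rewrite linearP. Qed.
Let linMm : is_linear (hMm h). Proof. by move=> c u v; rewrite linearP. Qed.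
Let linMp : is_linear (hMp h). Proof. by move=> c u v; rewrite linearP. Qed.
Let linJp : is_linear (hJp h). Proof. by move=> c u v; rewrite linearP. Qed.

Lemma hom_trp a b c : hJp h (trp a b c) = trp (hJp h a) (hJm h b) (hJp h c).
Proof. by rewrite -!trpE /jD /polar !(linE linJp) !hom_Qp !(linE linJp). Qed.
Lemma hom_trm a b c : hJm h (trm a b c) = trm (hJm h a) (hJp h b) (hJm h c).
Proof. by rewrite -!trmE /jD /polar !(linE linJm) !hom_Qm !(linE linJm). Qed.

Lemma uider_map_spec :
  [/\ is_linear (uider_map h),
      forall a b, uider_map h (diaJ a b) = diaJ (hJp h a) (hJm h b)
    & forall x y, uider_map h (diaM x y) = diaM (hMp h x) (hMm h y)].
Proof.
have [R1 R2 R3 R4 [R5 R6]] := dia_compat Q.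
apply: uider_lift_spec.
- split=> a c u v; first by rewrite linJm (diaJ_bil Q).1.
  by rewrite linJp ((diaJ_bil Q).2 _).
- split=> a c u v; first by rewrite linMm (diaM_bil Q).1.
  by rewrite linMp ((diaM_bil Q).2 _).
- split.
  + by move=> x y; rewrite hom_Vp hom_Vm R1.
  + by move=> x u y w; rewrite !hom_Vp !hom_Vm R2.
  + by move=> a b; rewrite hom_trp hom_trm R3.
  + by move=> a c b d; rewrite !hom_trp !hom_trm R4.
  split.
  + by move=> x u b; rewrite hom_kapp !hom_actm R5.
  + by move=> a y w; rewrite hom_kapm !hom_actp R6.
Qed.

Lemma uider_map_linear : is_linear (uider_map h).
Proof. by case: uider_map_spec. Qed.
Lemma uider_map_diaJ a b : uider_map h (diaJ a b) = diaJ (hJp h a) (hJm h b).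
Proof. by case: uider_map_spec. Qed.
Lemma uider_map_diaM x y : uider_map h (diaM x y) = diaM (hMp h x) (hMm h y).
Proof. by case: uider_map_spec. Qed.

(** Stated for [ud p] rather than for members of [ider P], since [h] need not induce a map to
    [ider Q]: a combination of generators vanishing on P can have an image acting nontrivially
    outside the image of [h]. *)
Lemma ud_map p :
  [/\ forall b, hJm h (onJm (ud p) b) = onJm (ud (uider_map h p)) (hJm h b),
      forall y, hMm h (onMm (ud p) y) = onMm (ud (uider_map h p)) (hMm h y),
      forall x, hMp h (onMp (ud p) x) = onMp (ud (uider_map h p)) (hMp h x)
    & forall a, hJp h (onJp (ud p) a) = onJp (ud (uider_map h p)) (hJp h a)].
Proof.
have lu := @ud_lin k P; have lu' := @ud_lin k Q; have lm := uider_map_linear.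
split=> d; move: p; apply: lin_uider_eq => [c p q|c p q|a b|x y].
- by rewrite (lu c p q) ((onJm_bil P).2 d c) linJm.
- by rewrite (lm c p q) (lu' c) ((onJm_bil Q).2 _ c).
- by rewrite uider_map_diaJ !ud_diaJ !genE (linN linJm) hom_trm.
- by rewrite uider_map_diaM !ud_diaM !genE (linN linJm) hom_kapm hom_actm.
- by rewrite (lu c p q) ((onMm_bil P).2 d c) linMm.
- by rewrite (lm c p q) (lu' c) ((onMm_bil Q).2 _ c).
- by rewrite uider_map_diaJ !ud_diaJ !genE (linN linMm) hom_actm hom_actp.
- by rewrite uider_map_diaM !ud_diaM !genE (linN linMm) hom_Vm.
- by rewrite (lu c p q) ((onMp_bil P).2 d c) linMp.
- by rewrite (lm c p q) (lu' c) ((onMp_bil Q).2 _ c).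
- by rewrite uider_map_diaJ !ud_diaJ !genE hom_actp hom_actm.
- by rewrite uider_map_diaM !ud_diaM !genE hom_Vp.
- by rewrite (lu c p q) ((onJp_bil P).2 d c) linJp.
- by rewrite (lm c p q) (lu' c) ((onJp_bil Q).2 _ c).
- by rewrite uider_map_diaJ !ud_diaJ !genE hom_trp.
- by rewrite uider_map_diaM !ud_diaM !genE hom_kapp hom_actp.
Qed.

Lemma pmod_map_ud p z :
  pmod_map h (ider_fun (ud p) z) = ider_fun (ud (uider_map h p)) (pmod_map h z).
Proof.
have [e1 e2 e3 e4] := ud_map p.
by rewrite !ider_funE /pmod_map !mkpE e1 e2 e3 e4.
Qed.

Lemma uider_map_br p q :
  uider_map h (uider_br p q) = uider_br (uider_map h p) (uider_map h q).
Proof.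
have [e1 e2 e3 e4] := ud_map p; have lm := uider_map_linear.
rewrite /uider_br !actE.
move: q; apply: lin_uider_eq => [c u v|c u v|a b|x y].
- by rewrite (act_lin (ud p) c u v) lm.
- by rewrite (lm c u v) (act_lin _ c).
- by rewrite act_diaJ (linD lm) !uider_map_diaJ act_diaJ e1 e4.
- by rewrite act_diaM (linD lm) !uider_map_diaM act_diaM e2 e3.
Qed.

End UiderMap.

(** * Central extensions and the functor ULE *)

Section CentralExtensions.
Variables (k : comPzRingType) (P : jkpair k).

(* What the construction needs of a Lie algebra D0 lying between uider and
   ider. *)
Definition ider_cover (D0 : lmodType k) (br0 : D0 -> D0 -> D0)
    (f : uider P -> D0) (g : D0 -> ider P) : Prop :=
  [/\ is_lie br0, is_linear f /\ is_linear g,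
      forall X Y, g (br0 X Y) = ider_br (g X) (g Y), forall p, g (f p) = ud p
    & forall X p, br0 X (f p) = f (uider_act (g X) p)].

Lemma lhat_five_graded (D0 : lmodType k) br0 f g :
  ider_cover br0 f g -> five_graded_lie (lhat_br br0 f g) (@lhat_deg k P D0).
Proof.
move=> [lie0 [linf ling] homg gf br0f]; split.
- exact: lhat_br_lie.
- by apply: lhat_graded => //; case: lie0.
- exact: lhat_deg_bound.
Qed.

Lemma uider_cover : ider_cover (@uider_br k P) idfun (@ud k P).
Proof.
split; [exact: uider_br_lie|split=> //; exact: ud_lin| |by []|by []].
by move=> p q; rewrite /uider_br actE ud_act.
Qed.

Lemma ider_ider_cover : ider_cover (@ider_br k P) (@ud k P) idfun.
Proof.
split; [exact: ider_br_lie|split=> //; exact: ud_lin|by []|by []|].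
by move=> T p; rewrite actE ud_act.
Qed.

Lemma central_ider_cover (D0 : lmodType k) br0 (f : uider P -> D0) g :
  is_lie br0 -> central_extension (@uider_br k P) br0 f ->
  central_extension br0 (@ider_br k P) g -> (forall p, g (f p) = ud p) ->
  ider_cover br0 f g.
Proof.
move=> lie0 [[linf homf] surjf _] [[ling homg] _ _] gf; split=> // X p.
by have [q <-] := surjf X; rewrite -homf gf.
Qed.

Lemma pmod_map_id (p : pmod P) : pmod_map (jkid P) p = p.
Proof. exact: pmod_eq. Qed.

Lemma lhat_central_extension (D1 D2 : lmodType k) br1 f1 g1 br2 f2 g2
    (phi : D1 -> D2) :
  ider_cover br1 f1 g1 -> ider_cover br2 f2 g2 ->
  central_extension br1 br2 phi -> (forall p, phi (f1 p) = f2 p) ->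
  (forall X, g2 (phi X) = g1 X) -> (forall X, exists p, f1 p = X) ->
  exists! F : lhat P D1 -> lhat P D2,
    graded_central_extension (lhat_br br1 f1 g1) (@lhat_deg k P D1)
      (lhat_br br2 f2 g2) (@lhat_deg k P D2) F
    /\ forall p : pmod P, F (p, 0) = (p, 0).
Proof.
move=> c1 c2 [[linphi homphi] surjphi kerphi] phif gphi surj1.
have [[bil1 _ _] [linf1 ling1] _ _ _] := c1; have [_ [linf2 ling2] _ _ _] := c2.
have FP p : lhat_map (jkid P) phi (p, 0) = (p, 0).
  by rewrite /lhat_map pmod_map_id (lin0 linphi).
have hom_map : lie_hom (lhat_br br1 f1 g1) (lhat_br br2 f2 g2)
    (lhat_map (jkid P) phi).
  by apply: lhat_map_hom => // X p; rewrite gphi !pmod_map_id.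
exists (lhat_map (jkid P) phi); split.
  split=> //; split.
  - exact: lhat_five_graded.
  - exact: lhat_five_graded.
  - split=> //.
    + apply: lhat_case => b y x a X; have [Y <-] := surjphi X.
      by exists (lmk b y x a Y).
    + apply: lhat_case => b y x a X E.
      have [-> -> -> -> EX] : lmk b y x a (phi X) = lmk 0 0 0 0 0 by exact: E.
      (* The kernel is that of [phi]. Its elements act on P through [g1], which factors through
         [phi], so they commute with P; with [D1] they commute by centrality of [phi]. *)
      have gX : g1 X = 0 by rewrite -gphi EX (lin0 ling2).
      apply: lhat_case => b' y' x' a' X'; rewrite lhat_brE // gX kerphi //.
      rewrite -[RHS]/(lmk 0 0 0 0 0); apply: lmk_eq;
        rewrite ?opE ?onlE ?onrE ?diaE ?(lin0 linf1); zmod.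
  - by move=> i z; apply: lhat_map_deg.
move=> F [[_ _ [homF _ _] _] FP'].
apply: (lhat_hom_eq linf1 bil1 ling1 surj1 hom_map homF).
by move=> p; rewrite FP FP'.
Qed.

End CentralExtensions.

Lemma ULE_map_hom (k : comPzRingType) (P Q : jkpair k) (h : jkhom P Q) :
  lie_hom (@ULE_br k P) (@ULE_br k Q) (ULE_map h).
Proof.
apply: (lhat_map_hom (h := h) (phi := uider_map h)) => //.
- exact: uider_map_linear.
- exact: uider_map_br.
- exact: uider_map_diaJ.
- exact: uider_map_diaM.
- by move=> p z; rewrite pmod_map_ud.
Qed.

Lemma uider_map_id (k : comPzRingType) (P : jkpair k) (p : uider P) :
  uider_map (jkid P) p = p.
Proof.
move: p; apply: lin_uider_eq => // [|a b|x y]; first exact: uider_map_linear.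
  by rewrite uider_map_diaJ.
by rewrite uider_map_diaM.
Qed.

Lemma uider_map_comp (k : comPzRingType) (P Q R : jkpair k)
    (h' : jkhom Q R) (h : jkhom P Q) (p : uider P) :
  uider_map (jkcomp h' h) p = uider_map h' (uider_map h p).
Proof.
move: p; apply: lin_uider_eq => [|c p q|a b|x y].
- exact: uider_map_linear.
- by rewrite (uider_map_linear h c) (uider_map_linear h' c).
- by rewrite !uider_map_diaJ.
- by rewrite !uider_map_diaM.
Qed.

Theorem proposition4p2p4 (k : comPzRingType) :
  (forall (P : jkpair k) (D0 : lmodType k) (br0 : D0 -> D0 -> D0)
          (f : uider P -> D0) (g : D0 -> ider P),
     is_lie br0 ->
     central_extension (@uider_br k P) br0 f ->
     central_extension br0 (@ider_br k P) g ->
     (forall p, g (f p) = ud p) ->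
     (* (i) *)
     five_graded_lie (lhat_br br0 f g) (@lhat_deg k P D0)
     (* (ii) *)
     /\ (exists! fhat : ULE P -> lhat P D0,
           graded_central_extension
             (@ULE_br k P) (@lhat_deg k P (uider P))
             (lhat_br br0 f g) (@lhat_deg k P D0) fhat
           /\ forall p : pmod P, fhat (p, 0) = (p, 0))
     /\ (exists! ghat : lhat P D0 -> TKK P,
           graded_central_extension
             (lhat_br br0 f g) (@lhat_deg k P D0)
             (@TKK_br k P) (@lhat_deg k P (ider P)) ghat
           /\ forall p : pmod P, ghat (p, 0) = (p, 0)))
  (* (iii) *)
  /\ [/\ forall P : jkpair k, is_lie (@ULE_br k P),
         forall (P Q : jkpair k) (h : jkhom P Q),
           lie_hom (@ULE_br k P) (@ULE_br k Q) (ULE_map h),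
         forall (P : jkpair k) (z : ULE P), ULE_map (jkid P) z = z,
         forall (P Q R : jkpair k) (h' : jkhom Q R) (h : jkhom P Q) (z : ULE P),
           ULE_map (jkcomp h' h) z = ULE_map h' (ULE_map h z)
       & forall (P Q : jkpair k) (h : jkhom P Q),
           unique (fun F : ULE P -> ULE Q =>
                     lie_hom (@ULE_br k P) (@ULE_br k Q) F
                     /\ forall p : pmod P, F (p, 0) = (pmod_map h p, 0))
                  (ULE_map h)].
split=> [P D0 br0 f g lie0 cf cg gf|].
  have c0 := central_ider_cover lie0 cf cg gf.
  have [[linf homf] surjf kerf] := cf.
  split; first exact: lhat_five_graded.
  split.
    (* The source is the cover given by the identity of [uider P] and [phi] is [f]. For the second
       map the target is the cover given by the identity of [ider P], and [phi] is [g]. *)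
    apply: (lhat_central_extension (uider_cover P) c0 cf _ gf) => // p.
    by exists p.
  exact: (lhat_central_extension c0 (ider_ider_cover P) cg gf _ surjf).
split.
- by move=> P; have [] := lhat_five_graded (uider_cover P).
- exact: ULE_map_hom.
- move=> P [p q]; rewrite /ULE_map /= pmod_map_id uider_map_id //.
- by move=> P Q R h' h [p q]; rewrite /ULE_map /= uider_map_comp.
- move=> P Q h; have lm := uider_map_linear h.
  have map0 p : ULE_map h (p, 0) = (pmod_map h p, 0).
    by rewrite /ULE_map /= (lin0 lm).
  split=> [|F [homF FP]]; first by split=> //; apply: ULE_map_hom.
  have [[bil _ _] _ _ _ _] := uider_cover P.
  apply: (lhat_hom_eq _ bil (@ud_lin k P) _ (ULE_map_hom h) homF) => [//|p|p].
    by exists p.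
  by rewrite map0 FP.
Qed.
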